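(* Let $m$ be a known positive integer and let $x_1,x_2,\ldots$ be i.i.d. observations from the finite normal mixture $$f(x;G^* )=\sum_{j=1}^m\alpha_j^*\phi(x;\theta_j^*,\sigma_j^{*2}),$$ where $G^*\in\mathbb{G}_m$. Let $\tilde\ell_n(G)=\ell_n(G)+p_n(G)$ be the penalized log-likelihood with penalty $p_n$ satisfying: P1. $p_n(G)=\sum_{j=1}^m\tilde p_n(\sigma_j)$. P2. $\sup_{\sigma>0}[\tilde p_n(\sigma)]^+=o(n)$, and $\tilde p_n(\sigma)=o(n)$ for each $\sigma>0$. P3. $\tilde p_n(\sigma)<(\log n)^2\log\sigma$ for all $0<\sigma<n^{-1}\log n$ when $n$ is large enough. Let $\tilde G_n$ be a penalized MLE, i.e. a global maximizer of $\tilde\ell_n(G)$ over $\mathbb{G}_m$. Then $\tilde G_n$ is consistent: $\tilde G_n\to G^*$ almost surely as $n\to\infty$.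
   Context: $\phi(x;\theta,\sigma^2)=\frac{1}{\sqrt{2\pi}\,\sigma}\exp\{-(x-\theta)^2/(2\sigma^2)\}$. $\mathbb{G}_m$ is the set of mixing distributions on $\mathbb{R}\times(0,\infty)$ with at most $m$ support points; $G\in\mathbb{G}_m$ places mass $\alpha_j\ge0$ ($\sum_j\alpha_j=1$) on $(\theta_j,\sigma_j)$, $j=1,\ldots,m$, and $f(x;G)=\sum_{j=1}^m\alpha_j\phi(x;\theta_j,\sigma_j^2)$ (component variances are allowed to be unequal). $G$ is handled through its $m$-component parametrization $(\alpha_j,\theta_j,\sigma_j)_{j=1}^m$, so that $p_n(G)$ is a function of $\sigma_1,\ldots,\sigma_m$. $\ell_n(G)=\sum_{i=1}^n\log f(x_i;G)$. $\tilde p_n$ is a real-valued function on $(0,\infty)$ for each $n$; $[\cdot]^+$ is the positive part. Convergence $\tilde G_n\to G^*$ is convergence in distribution, i.e. in the distance $D_{KW}(G_1,G_2)=\int|G_1(\vartheta)-G_2(\vartheta)|\exp(-|\vartheta|)\,d\vartheta$ over $\vartheta=(\theta,\sigma)\in\mathbb{R}\times(0,\infty)$, with $|\vartheta|=|\theta|+|\sigma|$ and $G_i(\cdot)$ denoting c.d.f.s. *)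

(* Defs.v *)
From HB Require Import structures.
From mathcomp Require Import all_boot all_order all_algebra.
From mathcomp Require Import all_classical all_reals all_analysis.

Set Implicit Arguments.
Unset Strict Implicit.
Unset Printing Implicit Defensive.

Import Order.TTheory GRing.Theory Num.Theory.
Import numFieldNormedType.Exports.

Local Open Scope classical_set_scope.
Local Open Scope ring_scope.

(* Mixing distributions on R x (0, oo) with at most m support points, through
   their m-component parametrization: weights may vanish and support points may
   coincide. *)
Record mixing (R : realType) (m : nat) := Mixing {
  weight : 'I_m -> R;
  mean : 'I_m -> R;
  sdev : 'I_m -> R;
  weight_ge0 : forall j, 0 <= weight j;
  weight_sum1 : \sum_(j < m) weight j = 1;
  sdev_gt0 : forall j, 0 < sdev j
}.

Section mixture.
Context {R : realType} {m : nat}.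
Implicit Types (G : mixing R m) (x : nat -> R).

(* The second parameter of normal_pdf is the standard deviation. *)
Definition mixture_pdf G (y : R) : R :=
  \sum_(j < m) weight G j * normal_pdf (mean G j) (sdev G j) y.

(* The observations are numbered from 0. *)
Definition loglik x (n : nat) G : R := \sum_(i < n) ln (mixture_pdf G (x i)).

Definition penalized_loglik (pen : nat -> mixing R m -> R) x (n : nat) G : R :=
  loglik x n G + pen n G.

Definition is_penalized_mle (pen : nat -> mixing R m -> R) x (n : nat) G : Prop :=
  forall G', penalized_loglik pen x n G' <= penalized_loglik pen x n G.

Definition mixing_cdf G (v : R * R) : R :=
  \sum_(j < m | (mean G j <= v.1) && (sdev G j <= v.2)) weight G j.

Definition D_KW G1 G2 : \bar R :=
  \int[(lebesgue_measure \x lebesgue_measure)%E]_(v in [set v : R * R | 0 < v.2])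
    (`|mixing_cdf G1 v - mixing_cdf G2 v| * expR (- (`|v.1| + `|v.2|)))%:E.

End mixture.

Section sampling.
Context {R : realType} {d : measure_display} {Omega : measurableType d}
  (P : probability Omega R).

Definition mutually_independent (X : nat -> {RV P >-> R}) : Prop :=
  forall (s : seq nat) (A : nat -> set R), uniq s ->
    (forall i, measurable (A i)) ->
    P (\bigcap_(i in [set` s]) (X i @^-1` A i)) =
      (\prod_(i <- s) P (X i @^-1` A i))%E.

Definition has_density (X : {RV P >-> R}) (f : R -> R) : Prop :=
  forall A : set R, measurable A ->
    P (X @^-1` A) = (\int[lebesgue_measure]_(y in A) (f y)%:E)%E.

Definition iid_with_density (X : nat -> {RV P >-> R}) (f : R -> R) : Prop :=
  mutually_independent X /\ forall i, has_density (X i) f.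

End sampling.

Section penalty.
Context {R : realType}.
Implicit Types q : nat -> R -> R.

Definition penalty_P1 {m : nat} (pen : nat -> mixing R m -> R) q : Prop :=
  forall n (G : mixing R m), pen n G = \sum_(j < m) q n (sdev G j).

(* The supremum is taken in \bar R: a real-valued sup would be 0 on an
   unbounded set. *)
Definition penalty_P2 q : Prop :=
  ((ereal_sup [set (Num.max (q n s) 0)%:E | s in [set s : R | 0 < s]%R] *
      (n%:R^-1)%:E)%E @[n --> \oo] --> 0%E) /\
  (forall s : R, 0 < s -> q n s / n%:R @[n --> \oo] --> (0 : R)).

Definition penalty_P3 q : Prop :=
  \forall n \near \oo, forall s : R, 0 < s -> s < n%:R^-1 * ln n%:R ->
    q n s < ln n%:R ^+ 2 * ln s.

End penalty.

(* Main.v *)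
(* Fix a typical sample and an ultrafilter refining n -> oo. Along it each
   component of the maximizer either converges to a normal component, or
   flattens out (s -> oo, or |t| -> oo), or degenerates (s -> 0). A degenerate
   component is large only on a window around t; the number of observations in
   any window of radius r is O(n r + ln n), uniformly, so the likelihood gained
   there is o(n), or is cancelled by the penalty when s < ln n / n. Hence the
   limit f0 of the mixture densities (possibly of mass < 1) satisfies
     sum_(i < n) ln ((f0 + e)(x_i) / f(x_i)) >= - o(n)        for every e > 0.
   Since ln u <= 4 (u^(1/4) - 1), the law of large numbers gives
   1 <= int ((f0 + e) / f)^(1/4) f, and e -> 0 yields 1 <= int f0^(1/4) f^(3/4).
   By the equality case of AM-GM, f0 = f, so no mass is lost, and normal mixtures
   are identifiable. The fourth root is what makes the test functions square
   integrable under f although e is not integrable. *)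

Require Import Defs.
From HB Require Import structures.
From mathcomp Require Import all_boot all_order all_algebra.
From mathcomp Require Import all_classical all_reals all_analysis.
From mathcomp Require Import measurable_realfun.
From mathcomp Require Import ring lra zify.
Set Implicit Arguments.
Unset Strict Implicit.
Unset Printing Implicit Defensive.
Import Order.TTheory GRing.Theory Num.Theory.
Import numFieldNormedType.Exports.
Local Open Scope classical_set_scope.
Local Open Scope ring_scope.

(** * Strong law of large numbers *)

(** The limit [f0] depends on the sample point, so the law of large numbers cannot be applied to a
    test function built from it: the exceptional null set would vary with the sample. The law is
    used only for a countable family, the sums of normal densities with rational parameters plus a
    constant 1/(k+1), and [f0] is approximated uniformly by such sums. Off one null set the argument
    is deterministic. The tests are nonnegative and only have to be bounded from above on average,
    so half of the strong law suffices; Chebyshev's inequality for uncorrelated variables of bounded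
    variance gives it. The constant e keeps the limit density away from 0, so that an excess E at an
    observation costs only ln (1 + E/e); it also swallows flat components and the rational
    approximation. It stays fixed while n grows, and tends to 0 only after the passage to integrals,
    where integrability of sqrt f controls its contribution. *)

Lemma ge0_integral_prod_mul {R : realType} {d1 d2 : measure_display}
    {T1 : measurableType d1} {T2 : measurableType d2}
    (m1 : {sigma_finite_measure set T1 -> \bar R})
    (m2 : {sigma_finite_measure set T2 -> \bar R}) (u : T1 -> R) (w : T2 -> R) :
  measurable_fun setT u -> measurable_fun setT w ->
  (forall x, 0 <= u x) -> (forall y, 0 <= w y) ->
  (\int[(m1 \x m2)%E]_v (u v.1 * w v.2)%:E =
   \int[m1]_x (u x)%:E * \int[m2]_y (w y)%:E)%E.
Proof.
move=> mu mw u0 w0.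
have meu : measurable_fun setT (EFin \o u) by exact/measurable_EFinP.
have mew : measurable_fun setT (EFin \o w) by exact/measurable_EFinP.
rewrite fubini_tonelli1//; last 2 first.
- apply/measurable_EFinP; apply: measurable_funM.
    by apply: measurableT_comp => //; exact: measurable_fst.
  by apply: measurableT_comp => //; exact: measurable_snd.
- by move=> v; rewrite lee_fin mulr_ge0.
under eq_integral => x _.
  rewrite /fubini_F /=.
  under eq_integral => y _ do rewrite /= EFinM.
  rewrite ge0_integralZl//; last 2 first.
    by move=> y _; rewrite lee_fin.
    by rewrite lee_fin.
  over.
rewrite ge0_integralZr//; last 2 first.
  by move=> y _; rewrite lee_fin.
by apply: integral_ge0 => y _; rewrite lee_fin.
Qed.

(** * Expectations computed through a density *)

Section density.
Context {R : realType} {d : measure_display} {Omega : measurableType d}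
  (P : probability Omega R) (X : {RV P >-> R}) (f : R -> R).
Hypotheses (f_ge0 : forall y, 0 <= f y) (f_meas : measurable_fun setT f)
  (Xf : has_density X f).
Notation mu := (@lebesgue_measure R).

Lemma density_integral1 : (\int[mu]_y (f y)%:E = 1)%E.
Proof. by rewrite -Xf//= probability_setT. Qed.

(** The law of [X] is dominated by Lebesgue measure and [f] agrees almost everywhere with its
    Radon-Nikodym derivative, so the change of variables for that derivative applies. *)
Lemma ge0_integral_density (h : R -> R) : measurable_fun setT h ->
  (forall y, 0 <= h y) ->
  (\int[P]_w (h (X w))%:E = \int[mu]_y (h y * f y)%:E)%E.
Proof.
move=> mh h0.
have mf : measurable_fun setT (EFin \o f) by exact/measurable_EFinP.
have mX : @measurable_fun _ _ Omega (measurableTypeR R) setT X.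
  exact: (measurable_funPT X).
pose X' : {mfun Omega >-> measurableTypeR R} :=
  HB.pack (X : Omega -> measurableTypeR R) (isMeasurableFun.Build _ _ _ _ _ mX).
pose nu : probability (measurableTypeR R) R := distribution P X'.
have dom : nu `<< mu.
  apply/null_content_dominatesP => A mA A0.
  rewrite -[nu A]/(P (X @^-1` A)) Xf//.
  by apply: null_set_integral => //; exact: measurable_funTS.
have mh' : @measurable_fun _ _ (measurableTypeR R) _ setT (EFin \o h).
  exact/measurable_EFinP.
transitivity (\int[nu]_y (EFin \o h) y)%E.
  by rewrite (ge0_integral_distribution X' mh')//= => y; rewrite lee_fin.
rewrite -(@Radon_Nikodym_SigmaFinite.change_of_variables _ _ _ nu mu dom)//=.
have fi : mu.-integrable setT (EFin \o f).
  apply/integrableP; split => //.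
  under eq_integral do rewrite gee0_abs ?lee_fin//.
  by rewrite density_integral1 ltry.
have e : ae_eq mu setT (EFin \o f)
    (Radon_Nikodym_SigmaFinite.f nu mu).
  apply: integral_ae_eq => //.
    exact: measurable_int (Radon_Nikodym_SigmaFinite.f_integrable dom).
  by move=> E _ mE; rewrite -Radon_Nikodym_SigmaFinite.f_integral// -Xf.
under [RHS]eq_integral do rewrite EFinM.
apply: ae_eq_integral => //.
- apply: emeasurable_funM => //.
  exact: measurable_int (Radon_Nikodym_SigmaFinite.f_integrable dom).
- exact: emeasurable_funM.
- by apply: ae_eqe_mul2l; exact: ae_eq_sym.
Qed.
End density.

Lemma Lfun2_of_sqr_integrable {R : realType} {d : measure_display} {T : measurableType d}
    (mu : {measure set T -> \bar R}) (f : T -> R) : measurable_fun setT f ->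
  (\int[mu]_x (f x ^+ 2)%:E < +oo)%E -> f \in Lfun mu 2%:E.
Proof.
move=> mf f2; rewrite inE; apply/andP; split; rewrite inE//=.
rewrite /finite_norm; apply: (@lty_poweRy _ _ 2) => //.
rewrite powR_Lnorm//; apply: le_lt_trans f2.
rewrite le_eqVlt; apply/orP; left; apply/eqP; apply: eq_integral => x _.
by rewrite /= powR_mulrn// real_normK ?num_real.
Qed.

Section slln.
Context {R : realType} {d : measure_display} {Omega : measurableType d}
  (P : probability Omega R) (Y : nat -> {RV P >-> R}).
Local Open Scope ereal_scope.

Let S n : Omega -> R := (fun w => \sum_(i < n) Y i w)%R.

Lemma measurable_partial_sum n : measurable_fun setT (S n).
Proof. by apply: measurable_sum => i; exact: measurable_funPT. Qed.

Lemma Lfun2_partial_sum n : (forall i, (Y i : Omega -> R) \in Lfun P 2%:E) ->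
  S n \in Lfun P 2%:E.
Proof.
move=> Y2; rewrite (_ : S n = \sum_(i < n) (Y i : Omega -> R))%R; last first.
  by apply/funext => w; rewrite /S fct_sumE.
have [L0 LD] : addr_closed (Lfun P 2%:E) by apply: Lfun_addr_closed; rewrite lee1n.
by elim/big_ind: _ => // f g; exact: LD.
Qed.

Lemma partial_sum_recr n : S n.+1 = (S n \+ Y n)%R.
Proof. by apply/funext => w; rewrite /S big_ord_recr. Qed.

Lemma covariance_partial_sum n j : (forall i, (Y i : Omega -> R) \in Lfun P 2%:E) ->
  (forall i, i != j -> covariance P (Y i) (Y j) = 0) -> (n <= j)%N ->
  covariance P (S n) (Y j) = 0.
Proof.
move=> Y2 cov0; elim: n => [_|n IH nj].
  rewrite (_ : S 0 = cst 0%R) ?covariance_cst_l//.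
  by apply/funext => w; rewrite /S big_ord0.
rewrite partial_sum_recr covarianceDl ?Lfun2_partial_sum// IH ?(ltnW nj)// cov0 ?adde0//.
by rewrite ltn_eqF.
Qed.

Lemma variance_partial_sum_le n c : (forall i, (Y i : Omega -> R) \in Lfun P 2%:E) ->
  (forall i j, i != j -> covariance P (Y i) (Y j) = 0) ->
  (forall i, 'V_P[Y i] <= c%:E) -> 'V_P[S n] <= (n%:R * c)%:E.
Proof.
move=> Y2 cov0 Vc; elim: n => [|n IH].
  rewrite (_ : S 0 = cst 0%R) ?variance_cst ?mul0r//.
  by apply/funext => w; rewrite /S big_ord0.
rewrite partial_sum_recr varianceD ?Lfun2_partial_sum// covariance_partial_sum//; last by move=> i; exact: cov0.
by rewrite mule0 adde0 -natr1 mulrDl mul1r EFinD leeD.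
Qed.

Lemma expectation_partial_sum n a : (forall i, (Y i : Omega -> R) \in Lfun P 1) ->
  (forall i, 'E_P[Y i] = a%:E) -> 'E_P[S n] = (n%:R * a)%:E.
Proof.
move=> Y1 Ya; elim: n => [|n IH].
  rewrite (_ : S 0 = cst 0%R) ?expectation_cst ?mul0r//.
  by apply/funext => w; rewrite /S big_ord0.
rewrite partial_sum_recr expectationD// ?IH ?Ya -?natr1 ?mulrDl ?mul1r//.
rewrite (_ : S n = \sum_(i < n) (Y i : Omega -> R))%R; last first.
  by apply/funext => w; rewrite /S fct_sumE.
exact: rpred_sum.
Qed.


(** Telescoping: 1/k^2 is at most 2/k - 2/(k+1) for k >= 1. The bound makes the exceptional
    probabilities summable in both Borel-Cantelli arguments. *)
Lemma sum_inv_sqr_le (n : nat) :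
  (\sum_(0 <= k < n) (k.+1%:R ^+ 2)^-1 <= 2 - 2 / n.+1%:R :> R)%R.
Proof.
elim: n => [|n IH]; first by rewrite big_nil invr1; lra.
rewrite big_nat_recr//= (le_trans (lerD IH (lexx _)))//.
rewrite -[(n.+2%:R)%R]natr1.
have : (1 <= n.+1%:R :> R)%R by rewrite ler1n.
move: (n.+1%:R)%R => x x1.
rewrite -subr_ge0 (_ : (_ - _ = (x - 1) / (x ^+ 2 * (x + 1)))%R).
  by rewrite divr_ge0 ?mulr_ge0 ?sqr_ge0//; lra.
by field; apply/andP; split; lra.
Qed.

Lemma nat_sqrt_bounds n : exists k, (k ^ 2 <= n < k.+1 ^ 2)%N.
Proof.
elim: n => [|n [k /andP[k1 k2]]]; first by exists 0%N.
have [h|h] := ltnP n.+1 (k.+1 ^ 2).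
  by exists k; rewrite h andbT (leq_trans k1).
exists k.+1; rewrite h/= ; move: k2; rewrite -!mulnn; nia.
Qed.

(* Chebyshev along the squares, where the error probabilities are summable;
   the partial sums being nondecreasing, the squares control every n. *)
Lemma slln_upper_bound a c : (0 <= a)%R -> (0 <= c)%R ->
  (forall i w, 0 <= Y i w)%R ->
  (forall i, (Y i : Omega -> R) \in Lfun P 2%:E) ->
  (forall i j, i != j -> covariance P (Y i) (Y j) = 0) ->
  (forall i, 'V_P[Y i] <= c%:E) -> (forall i, 'E_P[Y i] = a%:E) ->
  {ae P, forall w, forall e, (0 < e)%R ->
    \forall n \near \oo, (\sum_(i < n) Y i w <= n%:R * (a + e))%R}.
Proof.
move=> a0 c0 Y0 Y2 cov0 Vc Ya.
have Pfin : P setT \is a fin_num := fin_num_measure P _ measurableT.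
have Y1 i := Lfun_subset12 Pfin (Y2 i).
pose A e k := [set w | (k.+1 ^ 2)%:R * e <= `|S (k.+1 ^ 2) w - (k.+1 ^ 2)%:R * a|]%R.
have PA e k : (0 < e)%R ->
    P (A e k) <= (c / e ^+ 2 * (k.+1%:R ^+ 2)^-1)%:E.
  move=> e0; set n := (k.+1 ^ 2)%N.
  have n0 : (0 < n%:R :> R)%R by rewrite ltr0n expn_gt0.
  pose Sn : {RV P >-> R} :=
    HB.pack (S n) (isMeasurableFun.Build _ _ _ _ _ (measurable_partial_sum n)).
  have ne0 : (0 < n%:R * e)%R by rewrite mulr_gt0.
  have := chebyshev Sn ne0; rewrite /= (expectation_partial_sum _ Y1 Ya)//= => /le_trans; apply.
  rewrite (le_trans (lee_wpmul2l _ (variance_partial_sum_le n Y2 cov0 Vc)))//.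
    by rewrite lee_fin invr_ge0 exprn_ge0// ltW.
  rewrite -EFinM lee_fin le_eqVlt; apply/orP; left; apply/eqP.
  rewrite /n natrX; field.
  by rewrite (gt_eqF e0) nat1r pnatr_eq0.
have mA e k : measurable (A e k).
  rewrite /A -[X in measurable X]setTI.
  have mS : measurable_fun setT
      (fun w => `|S (k.+1 ^ 2) w - (k.+1 ^ 2)%:R * a|)%R.
    apply: measurableT_comp => //; apply: measurable_funB => //.
    exact: measurable_partial_sum.
  rewrite (_ : [set w | _] = (fun w => `|S (k.+1 ^ 2) w - (k.+1 ^ 2)%:R * a|)%R @^-1`
    `[((k.+1 ^ 2)%:R * e)%R, +oo[); first exact: mS.
  by apply/seteqP; split => w /=; rewrite in_itv/= andbT.
(* Borel-Cantelli: outside the limit superior of the deviation events, only finitely many of them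
   occur. *)
have ae1 e : (0 < e)%R -> {ae P, forall w, \forall k \near \oo,
    (S (k.+1 ^ 2) w <= (k.+1 ^ 2)%:R * (a + e))%R}.
  move=> e0; exists (lim_sup_set (A e)); split.
  - apply: bigcap_measurable => // k _.
    by apply: bigcup_measurable => j /= _; exact: mA.
  - apply: lim_sup_set_cvg0 => //.
    apply: (@le_lt_trans _ _ (c / e ^+ 2 * 2)%:E); last exact: ltry.
    apply: lime_le; first exact: is_cvg_nneseries.
    apply: nearW => n.
    apply: (@le_trans _ _ (\sum_(0 <= k < n) (c / e ^+ 2 * (k.+1%:R ^+ 2)^-1)%:E)).
      by apply: lee_sum => k _; exact: PA.
    rewrite sumEFin lee_fin -mulr_sumr ler_wpM2l ?divr_ge0 ?sqr_ge0//.
    by rewrite (le_trans (sum_inv_sqr_le n))// gerBl divr_ge0.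
  - move=> w /=; apply: contra_notP => /=.
    move=> /existsNP[n0]; rewrite not_implyE => -[_] nA.
    exists n0 => // k /= kn.
    have : ~ A e k w by move=> Ak; apply: nA; exists k.
    rewrite /A /= => /negP; rewrite -ltNge => /(le_lt_trans (ler_norm _)) h.
    by rewrite mulrDr -lerBlDl ltW.
(* The tolerances are restricted to 1/(N+1) so that countably many null sets are joined. *)
have : {ae P, forall w, forall N : nat, \forall k \near \oo,
    (S (k.+1 ^ 2) w <= (k.+1 ^ 2)%:R * (a + N.+1%:R^-1))%R}.
  by apply: ae_foralln => N; apply: ae1; rewrite invr_gt0.
apply: filterS => w Sw e e0.
pose N := Num.truncn (2 / e).
have Ne : (N.+1%:R^-1 <= e / 2)%R.
  rewrite -[leRHS]invrK lef_pV2 ?posrE ?invr_gt0 ?divr_gt0// invf_div.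
  exact: ltW (truncnS_gt _).
have [K _ SK] := Sw N.
(* Half of [e] is spent on the deviation along the squares. Past [K2] the other half pays for
   passing from k^2 to (k+1)^2: (k+1)^2 (a + e/2) <= k^2 (a + e). *)
pose K2 := Num.truncn (6 * (a + e) / e).
exists ((maxn K K2).+1 ^ 2)%N => // n /= Kn.
have [k /andP[k1 k2]] := nat_sqrt_bounds n.
have Kk : (maxn K K2 <= k)%N.
  have : ((maxn K K2).+1 ^ 2 < k.+1 ^ 2)%N by rewrite (leq_ltn_trans Kn).
  by rewrite ltn_exp2r// ltnS => /ltnW.
rewrite geq_max in Kk; case/andP: Kk => Kk K2k.
have Snk : (S n w <= S (k.+1 ^ 2) w)%R.
  have h j : (S n w <= S (n + j)%N w)%R.
    elim: j => [|j IH]; first by rewrite addn0.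
    by rewrite addnS partial_sum_recr /= (le_trans IH)// lerDl.
  by rewrite -(subnKC (ltnW k2)) h.
have {}SK := SK k Kk.
rewrite (le_trans Snk)// (le_trans SK)//.
have kn : (k%:R ^+ 2 <= n%:R :> R)%R by rewrite -natrX ler_nat.
have kK : (6 * (a + e) / e < k.+1%:R)%R.
  by rewrite (lt_le_trans (truncnS_gt _))// ler_nat ltnS.
rewrite ltr_pdivrMr// in kK.
have k1' : (1 <= k.+1%:R :> R)%R by rewrite ler1n.
rewrite natrX; rewrite -[(k.+1%:R)%R]natr1 in kK *; move: kn kK.
have : (0 <= k%:R :> R)%R by [].
move: (k%:R)%R (n%:R)%R => x y x0 xy xe.
have x1 : (1 <= x)%R by rewrite -(ler_pM2r e0); lra.
have h1 : (x * (6 * a + 5 * e) <= x * (x * e))%R by rewrite ler_wpM2l//; lra.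
have h2 : (a <= x * a)%R by rewrite ler_peMl.
have h3 : (e <= x * e)%R by rewrite ler_peMl// ltW.
apply: (@le_trans _ _ ((x + 1) ^+ 2 * (a + e / 2))%R).
  by rewrite ler_wpM2l ?sqr_ge0// lerD2l.
apply: (@le_trans _ _ (x ^+ 2 * (a + e))%R); first nra.
by rewrite ler_wpM2r//; lra.
Qed.
End slln.

(** * Products of functions of two independent variables *)

Section pair_independence.
Context {R : realType} {d : measure_display} {Omega : measurableType d}
  (P : probability Omega R) (X Y : {RV P >-> R}).
Hypothesis indep : forall A B : set R, measurable A -> measurable B ->
  P (X @^-1` A `&` Y @^-1` B) = (P (X @^-1` A) * P (Y @^-1` B))%E.

(** Independence says that the law of the pair agrees with the product of the laws on rectangles,
    hence everywhere by uniqueness of the product measure; Tonelli does the rest. *)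
Lemma ge0_expectation_mul_independent (h k : R -> R) :
  measurable_fun setT h -> measurable_fun setT k ->
  (forall y, 0 <= h y) -> (forall y, 0 <= k y) ->
  (\int[P]_w (h (X w) * k (Y w))%:E =
   \int[P]_w (h (X w))%:E * \int[P]_w (k (Y w))%:E)%E.
Proof.
move=> mh mk h0 k0.
pose Z w := (X w, Y w).
have mZ : measurable_fun setT Z.
  by apply: measurable_fun_pair; exact: measurable_funPT.
have mh' : measurable_fun setT (EFin \o h) by exact/measurable_EFinP.
have mk' : measurable_fun setT (EFin \o k) by exact/measurable_EFinP.
pose F (z : R * R) := (h z.1 * k z.2)%:E.
have mF : measurable_fun setT F.
  apply/measurable_EFinP; apply: measurable_funM.
    by apply: measurableT_comp => //; exact: measurable_fst.
  by apply: measurableT_comp => //; exact: measurable_snd.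
have F0 z : (0 <= F z)%E by rewrite lee_fin mulr_ge0.
pose nX : probability R R := distribution P X.
pose nY : probability R R := distribution P Y.
have -> : (\int[P]_w (h (X w) * k (Y w))%:E = \int[pushforward P Z]_z F z)%E.
  by rewrite ge0_integral_pushforward.
have -> : (\int[pushforward P Z]_z F z = \int[nX \x nY]_z F z)%E.
  apply: eq_measure_integral => A mA _.
  symmetry; apply: product_measure_unique => // B C mB mC.
rewrite (@ge0_integral_prod_mul _ _ _ _ _ nX nY h k)//.
by rewrite (ge0_integral_distribution X mh') ?(ge0_integral_distribution Y mk').
Qed.
End pair_independence.

Section slln_density.
Context {R : realType} {d : measure_display} {Omega : measurableType d}
  (P : probability Omega R) (X : nat -> {RV P >-> R}) (f : R -> R).
Hypotheses (f_ge0 : forall y, 0 <= f y) (f_meas : measurable_fun setT f)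
  (X_iid : iid_with_density X f).
Notation mu := (@lebesgue_measure R).

Lemma iid_pair_independent i j (A B : set R) : i != j ->
  measurable A -> measurable B ->
  P (X i @^-1` A `&` X j @^-1` B) = (P (X i @^-1` A) * P (X j @^-1` B))%E.
Proof.
move=> ij mA mB; have [+ _] := X_iid.
move=> /(_ [:: i; j] (fun k => if k == i then A else B)).
rewrite /= inE ij => /(_ isT) h.
rewrite !big_cons big_nil/= eqxx eq_sym (negbTE ij) mule1 in h.
rewrite -h; last by move=> k; case: ifP.
congr (P _); apply/seteqP; split => w /=.
  move=> [Aw Bw] k /=; rewrite !inE => /orP[/eqP->|/eqP->]; rewrite ?eqxx//.
  by rewrite eq_sym (negbTE ij).
move=> h'; split; first by have := h' i; rewrite /= mem_head eqxx; exact.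
by have := h' j; rewrite /= !inE eqxx orbT eq_sym (negbTE ij); exact.
Qed.

(** A finite second moment under [f] bounds all variances by one constant, and pairwise independence
    makes the covariances vanish. *)
Lemma iid_slln_upper_bound (g : R -> R) : measurable_fun setT g ->
  (forall y, 0 <= g y) -> (\int[mu]_y (g y ^+ 2 * f y)%:E < +oo)%E ->
  {ae P, forall w, forall e, 0 < e -> \forall n \near \oo,
    \sum_(i < n) g (X i w) <=
      n%:R * (fine (\int[mu]_y (g y * f y)%:E)%E + e)}.
Proof.
move=> mg g0 g2.
pose Y i : {RV P >-> R} := HB.pack (g \o X i) (isMeasurableFun.Build _ _ _ _ _
  (measurableT_comp mg (measurable_funPT (X i)))).
have Xf i : has_density (X i) f by case: X_iid.
have mg2 : measurable_fun setT (fun y => g y ^+ 2) by exact: measurable_funX.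
have Eg i : (\int[P]_w (g (X i w))%:E = \int[mu]_y (g y * f y)%:E)%E.
  exact: ge0_integral_density.
have Eg2 i : (\int[P]_w (g (X i w) ^+ 2)%:E = \int[mu]_y (g y ^+ 2 * f y)%:E)%E.
  by rewrite -(@ge0_integral_density _ _ _ P _ f f_ge0 f_meas (Xf i) _ mg2)// => y; exact: sqr_ge0.
have Y2 i : (Y i : Omega -> R) \in Lfun P 2%:E.
  apply: Lfun2_of_sqr_integrable; first exact: measurable_funPT.
  by rewrite Eg2.
have EY i : ('E_P[Y i] = \int[mu]_y (g y * f y)%:E)%E.
  by rewrite unlock Eg.
have Pfin : P setT \is a fin_num := fin_num_measure P _ measurableT.
have fE : (\int[mu]_y (g y * f y)%:E)%E \is a fin_num.
  by rewrite -(EY 0%N) expectation_fin_num// Lfun_subset12.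
have cov i j : i != j -> covariance P (Y i) (Y j) = 0%E.
  move=> ij; rewrite covarianceE ?Lfun2_mul_Lfun1 ?Lfun_subset12//.
  rewrite unlock /= (@ge0_expectation_mul_independent _ _ _ P (X i) (X j))//.
    by rewrite subee// fin_numM// Eg.
  by move=> A B mA mB; exact: iid_pair_independent.
have V i : ('V_P[Y i] <= (fine (\int[mu]_y (g y ^+ 2 * f y)%:E))%:E)%E.
  rewrite varianceE// EY -(fineK fE) -EFin_expe.
  rewrite (_ : 'E_P[Y i ^+ 2] = \int[mu]_y (g y ^+ 2 * f y)%:E)%E; last first.
    by rewrite unlock -(Eg2 i).
  rewrite -[X in (X - _ <= _)%E]fineK; last first.
    by rewrite ge0_fin_numE// integral_ge0// => y _; rewrite lee_fin mulr_ge0 ?sqr_ge0.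
  by rewrite -EFinB lee_fin gerBl sqr_ge0.
apply: (@slln_upper_bound _ _ _ P Y (fine (\int[mu]_y (g y * f y)%:E)%E)
  (fine (\int[mu]_y (g y ^+ 2 * f y)%:E)%E) _ _ _ Y2 cov V) => //.
- by rewrite fine_ge0// integral_ge0// => y _; rewrite lee_fin mulr_ge0.
- by rewrite fine_ge0// integral_ge0// => y _; rewrite lee_fin mulr_ge0 ?sqr_ge0.
- by move=> i w /=.
- by move=> i; rewrite fineK.
Qed.
End slln_density.

(** * Uniform bound on the number of observations in a window *)

Section counting.
Context {R : realType} {d : measure_display} {Omega : measurableType d}
  (P : probability Omega R) (X : nat -> {RV P >-> R}).
Variables (c : R -> nat) (q : nat -> R) (p : R).
Hypotheses (X_indep : mutually_independent X)
  (c_meas : forall g, measurable (c @^-1` [set g]))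
  (Xq : forall i g, P (X i @^-1` (c @^-1` [set g])) = (q g)%:E)
  (qp : forall g, q g <= p).

Lemma cell_prob_ge0 g : 0 <= q g.
Proof. by rewrite -lee_fin -(Xq 0%N). Qed.

Lemma cell_prob_sum_le1 : (\sum_(0 <= g <oo) (q g)%:E <= 1)%E.
Proof.
under eq_eseriesr do rewrite -(Xq 0%N).
have mU g : measurable (X 0%N @^-1` (c @^-1` [set g])) by exact: measurable_funPTI.
rewrite (_ : (\sum_(0 <= g <oo) _ = \sum_(0 <= g <oo | g \in setT)
    P (X 0%N @^-1` (c @^-1` [set g])))%E); last first.
  by apply: eq_eseriesl => g; rewrite in_setT.
rewrite -measure_bigcup//; last first.
  have := @trivIset_preimage1 _ _ setT (c \o X 0%N).
  by apply.
by apply: probability_le1; exact: bigcup_measurable.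
Qed.

Lemma prob_all_in_cell (s : seq nat) g : uniq s ->
  P (\bigcap_(i in [set` s]) (X i @^-1` (c @^-1` [set g]))) =
  (q g ^+ size s)%:E.
Proof.
move=> us; rewrite (@X_indep s (fun=> c @^-1` [set g]) us)//.
under eq_bigr do rewrite Xq.
rewrite prodEFin; congr EFin.
by elim: s {us} => [|i s IH]; rewrite ?big_nil// big_cons IH -exprS.
Qed.

Lemma measure_bigsetU_le (I : Type) (s : seq I) (Q : pred I) (F : I -> set Omega) :
  (forall i, measurable (F i)) ->
  (P (\big[setU/set0]_(i <- s | Q i) F i) <= \sum_(i <- s | Q i) P (F i))%E.
Proof.
move=> mF; elim: s => [|i s IH]; first by rewrite !big_nil measure0.
rewrite !big_cons; case: ifP => // Qi.
have mU := bigsetU_measurable s (fun i (_ : Q i) => mF i).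
apply: (@le_trans _ _ (P (F i) + P (\big[setU/set0]_(j <- s | Q j) F j))%E).
  exact: measureU2.
exact: leeD.
Qed.

(** Index sets of size exactly [k] are enough to witness [k] or more observations in a cell, and
    there are only C(n, k) of them for the union bound. *)
Let E n k g := \big[setU/set0]_(A : {set 'I_n} | #|A| == k)
  \bigcap_(i in [set` [seq val i | i <- enum A]]) (X i @^-1` (c @^-1` [set g])).

Let mcap n (A : {set 'I_n}) g : measurable
  (\bigcap_(i in [set` [seq val i | i <- enum A]]) (X i @^-1` (c @^-1` [set g]))).
Proof.
apply: fin_bigcap_measurable; first exact: finite_seq.
by move=> i _; exact: measurable_funPTI.
Qed.

Lemma crowded_cell_event_measurable n k : measurable (\bigcup_g E n k g).
Proof. by apply: bigcup_measurable => g _; exact: bigsetU_measurable. Qed.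

Lemma crowded_cell_in_event n k w :
  (exists g, (k <= #|[pred i : 'I_n | c (X i w) == g]|)%N) ->
  (\bigcup_g E n k g) w.
Proof.
move=> [g /card_geqP[s [us ss sub]]]; exists g => //.
rewrite /E -bigcup_seq_cond /=; exists [set i in s].
  by rewrite /= mem_index_enum/= cardsE (card_uniqP us) ss.
move=> _ /= /mapP[i + ->]; rewrite mem_enum inE => /sub.
by rewrite inE => /eqP.
Qed.

(* Union bound over the subsets of size k + 1 and the cells, the latter through
   sum_g q g ^ (k + 1) <= p ^ k * sum_g q g. *)
Lemma prob_crowded_cell_le n k : (P (\bigcup_g E n k.+1 g) <=
  ('C(n, k.+1)%:R * p ^+ k)%:E)%E.
Proof.
have q0 := cell_prob_ge0.
apply: (le_trans (@measure_sigma_subadditive _ _ _ P _ (E n k.+1) _ _ _)) => //.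
- by move=> g; exact: bigsetU_measurable.
- exact: crowded_cell_event_measurable.
apply: (@le_trans _ _ (\sum_(0 <= g <oo)
    (('C(n, k.+1)%:R * p ^+ k)%:E * (q g)%:E))%E).
  apply: lee_nneseries => [g _ //|g _].
  apply: le_trans; first by apply: measure_bigsetU_le => A; exact: mcap.
  rewrite (eq_bigr (fun=> (q g ^+ k.+1)%:E)); last first.
    move=> A /eqP kA; rewrite prob_all_in_cell ?size_map -?cardE ?kA//.
    by rewrite map_inj_uniq ?enum_uniq//; exact: val_inj.
  rewrite sumEFin big_const_seq iter_addr_0 -EFinM lee_fin.
  rewrite (_ : count _ _ = 'C(n, k.+1)); last first.
    rewrite -[in RHS](card_ord n) -card_draws -sum1_card -sum1_count.
    by rewrite big_mkcond/= [RHS]big_mkcond/=; apply: eq_bigr => A _; rewrite inE.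
  rewrite -[leLHS]mulr_natl -mulrA ler_wpM2l// exprSr ler_wpM2r// lerXn2r// nnegrE//.
  exact: le_trans (q0 g) (qp g).
rewrite nneseriesZl; last by move=> g _; rewrite lee_fin.
rewrite -[leRHS]mule1 lee_wpmul2l ?cell_prob_sum_le1// lee_fin mulr_ge0//.
by rewrite exprn_ge0// (le_trans (q0 0%N)).
Qed.
Lemma crowded_cell_exceptional_set n k : exists B : set Omega,
  [/\ measurable B, (P B <= ('C(n, k.+1)%:R * p ^+ k)%:E)%E &
   forall w, ~ B w -> forall g, (#|[pred i : 'I_n | c (X i w) == g]| <= k)%N].
Proof.
exists (\bigcup_g E n k.+1 g); split.
- exact: crowded_cell_event_measurable.
- exact: prob_crowded_cell_le.
- move=> w nB g; rewrite leqNgt; apply/negP => kg.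
  by apply/nB/crowded_cell_in_event; exists g.
Qed.
End counting.

Lemma ffact_le_exp n k : (n ^_ k <= n ^ k)%N.
Proof.
elim: k => [|k IH]; first by rewrite ffactn0 expn0.
by rewrite ffactnSr expnSr leq_mul// leq_subr.
Qed.

(** Since C(n, k+1) <= n^(k+1) / (k+1)!, the left side is at most n y^k / (k+1)!. One term of the
    exponential series gives (e y)^k / k! <= exp (e y), with e = exp 1. The spare factor exp (- k)
    is what lets k of order ln n suffice. *)
Lemma bin_exp_le {R : realType} (n k : nat) (y : R) : 0 <= y -> (0 < n)%N ->
  'C(n, k.+1)%:R * (y / n%:R) ^+ k <= n%:R * expR (expR 1 * y) / expR k%:R :> R.
Proof.
move=> y0 n0.
have n0' : 0 < n%:R :> R by rewrite ltr0n.
have h1 : 'C(n, k.+1)%:R * k.+1`!%:R <= n%:R ^+ k.+1 :> R.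
  by rewrite -natrM bin_ffact -natrX ler_nat ffact_le_exp.
have h2 : (expR 1 * y) ^+ k / k`!%:R <= expR (expR 1 * y).
  case: k {h1} => [|k].
    rewrite expr0 fact0 divr1; have := expR_ge1Dx (expR 1 * y).
    by apply: le_trans; rewrite lerDl mulr_ge0// expR_ge0.
  apply: le_trans (expR_ge1Dxn k _); last by rewrite mulr_ge0 ?expR_ge0.
  by rewrite lerDr.
have k0 : 0 < k`!%:R :> R by rewrite ltr0n fact_gt0.
have k1 : 0 < k.+1`!%:R :> R by rewrite ltr0n fact_gt0.
have kk : k`!%:R <= k.+1`!%:R :> R by rewrite ler_nat factS leq_pmull.
have e0 : 0 < expR k%:R :> R by exact: expR_gt0.
rewrite ler_pdivlMr//.
have -> : expR k%:R = expR 1 ^+ k :> R by rewrite -expRM_natl mulr1.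
rewrite -mulrA -exprMn.
apply: (@le_trans _ _ (n%:R ^+ k.+1 / k.+1`!%:R * (y / n%:R * expR 1) ^+ k)).
  rewrite ler_wpM2r ?exprn_ge0 ?mulr_ge0 ?divr_ge0 ?expR_ge0//.
  by rewrite ler_pdivlMr.
apply: (@le_trans _ _ (n%:R * ((expR 1 * y) ^+ k / k.+1`!%:R))).
  rewrite le_eqVlt; apply/orP; left; apply/eqP.
  rewrite exprS !exprMn exprVn; field.
  by rewrite !gt_eqF// exprn_gt0.
rewrite ler_wpM2l//; apply: le_trans h2.
rewrite ler_wpM2l ?exprn_ge0 ?mulr_ge0 ?expR_ge0//.
by rewrite lef_pV2.
Qed.

(** [pickle] numbers the integer cells by [nat], over which the union bound sums. A number that
    encodes no integer has an empty preimage. *)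
Definition grid_cell {R : realType} (h x : R) : nat := pickle (Num.floor (x / h)).

Lemma grid_cell_preimage {R : realType} (h : R) g : 0 < h ->
  grid_cell h @^-1` [set g] = set0 \/
  exists z : int, grid_cell h @^-1` [set g] = `[z%:~R * h, (z + 1)%:~R * h[%classic.
Proof.
move=> h0; have [[z zg]|ng] := pselect (exists z : int, pickle z = g).
  right; exists z; apply/seteqP; split => x /=.
    rewrite -zg /grid_cell => /(pcan_inj pickleK) /eqP.
    by rewrite floor_eq in_itv/= ler_pdivlMr// ltr_pdivrMr.
  rewrite in_itv/= -ler_pdivlMr// -ltr_pdivrMr// -floor_eq => /eqP zE.
  by rewrite -zg /grid_cell zE.
left; apply/seteqP; split => x //= xg; apply: ng.
by exists (Num.floor (x / h)).
Qed.

Lemma card_window_le {R : realType} (h : R) (x : nat -> R) (n k : nat) (t r : R) :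
  0 < h -> 0 <= r ->
  (forall g, (#|[pred i : 'I_n | grid_cell h (x i) == g]| <= k)%N) ->
  #|[pred i : 'I_n | `|x i - t| <= r]|%:R <= (2 * r / h + 2) * k%:R :> R.
Proof.
move=> h0 r0 xk; set a := Num.floor ((t - r) / h).
(* An interval of length 2 r meets at most floor (2 r / h) + 2 cells, since both ends may cut a
   cell. *)
pose T := (Num.truncn (2 * r / h)).+2.
have rh : 0 <= 2 * r / h by rewrite divr_ge0 ?mulr_ge0// ltW.
have cover (i : 'I_n) : `|x i - t| <= r ->
    (1 <= \sum_(s < T) (grid_cell h (x i) == pickle (a + s%:Z)%R))%N.
  rewrite ler_norml => /andP[l u].
  have al : (a <= Num.floor (x i / h))%R.
    by apply: le_floor; rewrite ler_pM2r ?invr_gt0//; lra.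
  have [s sE] : exists s : nat, Num.floor (x i / h) = a + s%:Z.
    exists `|Num.floor (x i / h) - a|%N; rewrite gez0_abs ?subr_ge0//.
    by rewrite addrCA subrr addr0.
  have sT : (s < T)%N.
    rewrite /T ltnS -(ler_nat R).
    have /andP[h1 _] := floor_itv (x i / h).
    have /andP[_ h2] := floor_itv ((t - r) / h).
    rewrite -/a sE in h1 h2.
    rewrite intrD -pmulrn in h1; rewrite intrD in h2.
    have h3 : x i / h <= (t - r) / h + 2 * r / h.
      by rewrite -mulrDl ler_pM2r ?invr_gt0//; lra.
    have h4 := truncnS_gt (2 * r / h).
    have : (s%:R < (Num.truncn (2 * r / h)).+1%:R + 1 :> R).
      move: h1 h2 h3 h4; rewrite mulr1z; lra.
    by rewrite natr1 ltr_nat ltnS ler_nat.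
  rewrite (bigD1 (Ordinal sT))//= {1}/grid_cell sE eqxx.
  by rewrite leq_addr.
have cardle : (#|[pred i : 'I_n | (`|x i - t| <= r)%R]| <= T * k)%N.
  rewrite -sum1_card.
  apply: (@leq_trans (\sum_(i < n) \sum_(s < T)
      (grid_cell h (x i) == pickle (a + s%:Z)%R))).
    rewrite [leqLHS]big_mkcond/=; apply: leq_sum => i _.
    by rewrite inE; case: ifP => // /cover.
  rewrite exchange_big/=.
  have -> : (T * k = \sum_(s < T) k)%N by rewrite sum_nat_const card_ord.
  apply: leq_sum => s _; apply: leq_trans (xk (pickle (a + s%:Z)%R)).
  by rewrite -sum1_card [leqRHS]big_mkcond/=; apply: leq_sum => i _; rewrite inE; case: eqP.
rewrite (le_trans (_ : _ <= (T * k)%:R)) ?ler_nat// natrM ler_wpM2r//.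
have := truncn_le (2 * r / h); rewrite rh => /esym.
rewrite /T -[(_.+2)%:R]natr1 -natr1; lra.
Qed.

Section window_count.
Context {R : realType} {d : measure_display} {Omega : measurableType d}
  (P : probability Omega R) (X : nat -> {RV P >-> R}) (f : R -> R) (M : R).
Hypotheses (f_ge0 : forall y, 0 <= f y) (f_meas : measurable_fun setT f)
  (f_le : forall y, f y <= M) (X_iid : iid_with_density X f).
Notation mu := (@lebesgue_measure R).

Lemma grid_cell_measurable (h : R) g : 0 < h -> measurable (grid_cell h @^-1` [set g]).
Proof. by move=> h0; have [->//|[z ->]] := grid_cell_preimage g h0. Qed.

Lemma prob_grid_cell_le (h : R) g i : 0 < h ->
  (P (X i @^-1` (grid_cell h @^-1` [set g])) <= (M * h)%:E)%E.
Proof.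
move=> h0; have [_ Xf] := X_iid; rewrite Xf; last exact: grid_cell_measurable.
have M0 : 0 <= M := le_trans (f_ge0 0) (f_le 0).
have [->|[z ->]] := grid_cell_preimage g h0.
  by rewrite integral_set0 lee_fin mulr_ge0// ltW.
apply: (@le_trans _ _ (\int[mu]_(y in `[(z%:~R * h)%R, ((z + 1)%:~R * h)%R[) M%:E)%E).
  apply: ge0_le_integral => //.
  - by move=> y _; rewrite lee_fin.
  - exact/measurable_EFinP/measurable_funTS.
  - by move=> y _; rewrite lee_fin.
rewrite integral_cst//= lebesgue_measure_itv/= lte_fin ltr_pM2r// ltr_int ltzD1 lexx.
by rewrite -EFinB -EFinM lee_fin -mulrBl intrD mulr1z addrAC subrr add0r mul1r.
Qed.

(* Cells have length ln n / n, so that a window of radius r meets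
   O(n r / ln n + 1) of them, and each holds O(ln n) observations. *)
Lemma iid_window_count_bound : exists2 C, 0 < C &
  {ae P, forall w, \forall n \near \oo, forall t r, 0 <= r ->
    #|[pred i : 'I_n | `|X i w - t| <= r]|%:R <= C * (n%:R * r + ln n%:R) :> R}.
Proof.
have M0 : 0 <= M := le_trans (f_ge0 0) (f_le 0).
have [Xind Xf] := X_iid.
(* With y = M ln n and k >= K ln n, [bin_exp_le] is at most exp ((1 + e M - K) ln n), where e = exp
   1; the 3 turns this into n^(-2), which is summable. *)
pose K : R := expR 1 * M + 3.
have K0 : 0 < K by rewrite /K ltr_wpDl// mulr_ge0// expR_ge0.
(* Shifting the sample size beyond exp 1 makes ln n at least 1, so that the cell length is positive
   for every [N]. *)
pose n0 := (Num.truncn (expR 1 : R)).+1.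
have ln1 (N : nat) : 1 <= ln (N + n0)%:R :> R.
  rewrite -[leLHS](expRK 1) ler_ln ?posrE ?expR_gt0 ?ltr0n ?addnS//.
  by apply: (le_trans (ltW (truncnS_gt (expR 1)))); rewrite ler_nat ?addnS ltnS leq_addl.
pose h N : R := ln (N + n0)%:R / (N + n0)%:R.
have h0 N : 0 < h N.
  apply: divr_gt0; first exact: lt_le_trans ltr01 (ln1 N).
  by rewrite ltr0n ?addnS.
pose k N := (Num.truncn (K * ln (N + n0)%:R)).+1.
have exB N : exists B : set Omega, [/\ measurable B,
    (P B <= ((N.+1%:R ^+ 2)^-1)%:E)%E & forall w, ~ B w -> forall g,
    (#|[pred i : 'I_(N + n0) | grid_cell (h N) (X i w) == g]| <= k N)%N].
  pose q g := fine (P (X 0%N @^-1` (grid_cell (h N) @^-1` [set g]))).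
  have mc g := grid_cell_measurable g (h0 N).
  have Xq i g : P (X i @^-1` (grid_cell (h N) @^-1` [set g])) = (q g)%:E.
    rewrite /q fineK ?fin_num_measure//; last exact: measurable_funPTI.
    by rewrite !Xf.
  have qp g : q g <= M * h N.
    by rewrite -lee_fin -(Xq 0%N) prob_grid_cell_le.
  have [B [mB PB HB]] := crowded_cell_exceptional_set Xind mc Xq qp (N + n0) (k N).
  exists B; split => //; apply: (le_trans PB); rewrite lee_fin /h mulrA.
  set n := (N + n0)%N; have nn0 : (0 < n)%N by rewrite /n addnS.
  have n0' : 0 < n%:R :> R by rewrite ltr0n.
  have L1 : 1 <= ln n%:R :> R := ln1 N.
  rewrite (le_trans (bin_exp_le _ _ nn0)) ?mulr_ge0 ?(le_trans ler01 L1)//.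
  apply: (@le_trans _ _ ((n%:R ^+ 2)^-1)); last first.
    rewrite lef_pV2 ?posrE ?exprn_gt0// lerXn2r ?nnegrE//.
    by rewrite ler_nat /n addnS ltnS leq_addr.
  have -> : (n%:R ^+ 2)^-1 = expR (- (2 * ln n%:R)) :> R.
    by rewrite expRN expRM_natl lnK// posrE.
  have {1}-> : n%:R = expR (ln n%:R) :> R by rewrite lnK// posrE.
  rewrite -expRN -!expRD ler_expR.
  have : K * ln n%:R <= (k N)%:R by rewrite ltW// truncnS_gt.
  rewrite /K; lra.
have [B /all_and3[mB PB HB]] := choice exB.
exists (2 * (K + 1)); first by rewrite mulr_gt0// addr_gt0.
exists (lim_sup_set B); split.
- apply: bigcap_measurable => // j _.
  by apply: bigcup_measurable => i /= _.
- apply: lim_sup_set_cvg0 => //.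
  apply: (@le_lt_trans _ _ 2%:E); last exact: ltry.
  apply: lime_le; first exact: is_cvg_nneseries.
  apply: nearW => n.
  apply: (@le_trans _ _ (\sum_(0 <= k < n) ((k.+1%:R ^+ 2)^-1)%:E)%E).
    by apply: lee_sum => i _; exact: PB.
  rewrite sumEFin lee_fin (le_trans (sum_inv_sqr_le n))//.
  by rewrite gerBl divr_ge0.
move=> w /=; apply: contra_notP => /=.
move=> /existsNP[N1]; rewrite not_implyE => -[_] nB.
exists (N1 + n0)%N => // n /= Nn t r r0.
have nE : n = (n - n0 + n0)%N by rewrite subnK// (leq_trans _ Nn)// leq_addl.
move: (n - n0)%N nE => N nE; rewrite nE leq_add2r in Nn; subst n.
have {}nB : ~ B N w by move=> BN; apply: nB; exists N.
apply: (le_trans (@card_window_le _ _ (fun i => X i w) _ _ t _ (h0 N) r0 (HB N w nB))).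
set n := (N + n0)%N; have n0' : 0 < n%:R :> R by rewrite ltr0n /n addnS.
have L1 : 1 <= ln n%:R :> R := ln1 N.
have kle : (k N)%:R <= (K + 1) * ln n%:R.
  have KL : 0 <= K * ln n%:R by rewrite mulr_ge0 ?(ltW K0)// (le_trans ler01).
  have := truncn_le (K * ln n%:R); rewrite KL => /esym.
  rewrite /k -natr1; lra.
apply: (@le_trans _ _ ((2 * r / h N + 2) * ((K + 1) * ln n%:R))).
  apply: ler_wpM2l => //; apply: addr_ge0 => //.
  by rewrite divr_ge0 ?(ltW (h0 N))// mulr_ge0.
rewrite le_eqVlt; apply/orP; left; apply/eqP; rewrite /h -/n; field.
by rewrite !gt_eqF// (lt_le_trans ltr01).
Qed.
End window_count.

(** * Normal densities *)

Section normal_pdf_bounds.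
Context {R : realType}.
Implicit Types m s x t w : R.

Lemma normal_pdf_gt0 m s x : 0 < s -> 0 < normal_pdf m s x.
Proof.
move=> s0; rewrite normal_pdfE ?gt_eqF// mulr_gt0 ?expR_gt0//.
by rewrite normal_peak_gt0// gt_eqF.
Qed.

Lemma normal_peak_le_inv s : 0 < s -> normal_peak s <= s^-1.
Proof.
move=> s0; have pi1 : 1 <= pi :> R by rewrite (le_trans _ (pi_ge2 R))// ler1n.
rewrite /normal_peak lef_pV2 ?posrE//; last first.
  by rewrite sqrtr_gt0 mulrn_wgt0// mulr_gt0 ?exprn_gt0// pi_gt0.
rewrite -[leLHS]ger0_norm ?(ltW s0)// -sqrtr_sqr ler_wsqrtr//.
rewrite -mulrnAr ler_peMr ?sqr_ge0// mulr2n.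
by rewrite (le_trans pi1)// lerDl (le_trans ler01).
Qed.

Lemma normal_peak_sub s t : 0 < s -> 0 < t ->
  `|normal_peak s - normal_peak t| <= `|s - t| / (s * t).
Proof.
move=> s0 t0.
have E (r : R) : 0 < r -> normal_peak r = r^-1 * normal_peak 1.
  move=> r0; rewrite /normal_peak expr1n mul1r -mulrnAr sqrtrM ?sqr_ge0//.
  by rewrite sqrtr_sqr ger0_norm ?(ltW r0)// invfM.
rewrite (E s)// (E t)// -mulrBl normrM (ger0_norm (normal_peak_ge0 _)).
apply: (@le_trans _ _ (`|s^-1 - t^-1| * 1)).
  by rewrite ler_wpM2l// (le_trans (normal_peak_le_inv ltr01))// invr1.
rewrite mulr1 (_ : s^-1 - t^-1 = (t - s) / (s * t)); last first.
  by field; rewrite !gt_eqF.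
by rewrite normrM distrC (ger0_norm (ltW _ : 0 <= (s * t)^-1))// invr_gt0 mulr_gt0.
Qed.

Lemma normal_pdf_le_inv m s x : 0 < s -> normal_pdf m s x <= s^-1.
Proof.
move=> s0; rewrite (le_trans (normal_pdf_ub _ _ _)) ?gt_eqF//.
exact: normal_peak_le_inv.
Qed.

Lemma normal_pdf_far m s w x : 0 < s -> 0 <= w -> w <= `|x - m| ->
  normal_pdf m s x <= s^-1 * expR (- (w ^+ 2 / (s ^+ 2 * 2))).
Proof.
move=> s0 w0 wx; rewrite normal_pdfE ?gt_eqF// ler_pM ?normal_peak_ge0 ?expR_ge0//.
  exact: normal_peak_le_inv.
rewrite ler_expR mulNr lerN2 (mulr_natr (s ^+ 2)) ler_pM2r; last first.
  by rewrite invr_gt0 mulrn_wgt0// exprn_gt0.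
by rewrite -(real_normK (num_real (x - m))) lerXn2r// nnegrE.
Qed.

Lemma expRN_sub_le (u v : R) : expR (- u) - expR (- v) <= (v - u) * expR (- u).
Proof.
have := expR_ge1Dx (u - v).
rewrite -(ler_pM2l (expR_gt0 (- u))) -expRD (_ : - u + (u - v) = - v) => [h|]; last by ring.
lra.
Qed.

Lemma mul_expRN_le1 (z : R) : z * expR (- z) <= 1.
Proof.
have := expR_ge1Dx z; rewrite expRN ler_pdivrMr ?expR_gt0// mul1r; lra.
Qed.

(** From exp (- z) <= 1/z with z = w^2 / (2 s^2) one gets 2 s / w^2. The weaker 2 s / w is easier to
    solve for [w]. *)
Lemma normal_pdf_far_le m s w x : 0 < s -> 1 <= w ->
  w <= `|x - m| -> normal_pdf m s x <= 2 * s / w.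
Proof.
move=> s0 w1 wx; have w0 : 0 < w by exact: lt_le_trans w1.
apply: (le_trans (normal_pdf_far s0 (ltW w0) wx)); set z := w ^+ 2 / (s ^+ 2 * 2).
have z0 : 0 < z by rewrite divr_gt0 ?mulr_gt0 ?exprn_gt0.
have ez : expR (- z) <= z^-1 by rewrite -[leRHS]mul1r ler_pdivlMr// mulrC mul_expRN_le1.
apply: (@le_trans _ _ (s^-1 * z^-1)); first by rewrite ler_wpM2l// invr_ge0 ltW.
have -> : s^-1 * z^-1 = 2 * s / w / w by rewrite /z; field; rewrite !gt_eqF.
by rewrite ler_pdivrMr// ler_peMr// divr_ge0 ?(ltW w0)// mulr_ge0// ltW.
Qed.

(** The difference of exponents is quadratic in [x], but it comes multiplied by exp (- u), and y^2
    exp (- u) <= 2 s^2 while |y| exp (- u) <= 3/2 s, the latter by AM-GM. This makes the bound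
    uniform in [x]. *)
Lemma gauss_sub_le (t s t0 s0 x : R) : 0 < s -> 0 < s0 ->
  expR (- (x - t) ^+ 2 / (s ^+ 2 *+ 2)) - expR (- (x - t0) ^+ 2 / (s0 ^+ 2 *+ 2))
  <= (`|s ^+ 2 - s0 ^+ 2| + 3 / 2 * s * `|t - t0| + `|t - t0| ^+ 2 / 2) / s0 ^+ 2.
Proof.
move=> sp s0p; rewrite !mulNr -(mulr_natr (s ^+ 2)) -(mulr_natr (s0 ^+ 2)).
set u := (x - t) ^+ 2 / (s ^+ 2 * 2); set v := (x - t0) ^+ 2 / (s0 ^+ 2 * 2).
apply: (le_trans (expRN_sub_le u v)); set E := expR (- u).
have E0 : 0 <= E by exact: expR_ge0.
have E1 : E <= 1.
  rewrite /E -expR0 ler_expR oppr_le0 /u; apply: divr_ge0; first exact: sqr_ge0.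
  by apply: mulr_ge0 => //; exact: sqr_ge0.
pose y := x - t; pose d := t - t0.
have y2E : y ^+ 2 * E <= 2 * s ^+ 2.
  have := mul_expRN_le1 u; rewrite -/E /u -/y mulrAC ler_pdivrMr; last first.
    by rewrite mulr_gt0 ?exprn_gt0.
  by rewrite mul1r [_ * 2]mulrC.
have yE : `|y| * E <= 3 / 2 * s.
  apply: (@le_trans _ _ ((y ^+ 2 * E / s + s * E) / 2)).
    rewrite ler_pdivlMr// -(ler_pM2r sp) mulrDl divfK ?gt_eqF//.
    have : 0 <= E * (`|y| - s) ^+ 2 by rewrite mulr_ge0 ?sqr_ge0.
    rewrite -(real_normK (num_real y)); nra.
  have h1 : y ^+ 2 * E / s <= 2 * s.
    by rewrite ler_pdivrMr// (le_trans y2E)// expr2 mulrA.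
  have h2 : s * E <= s by rewrite ler_piMr// ltW.
  lra.
have -> : (v - u) * E = ((y ^+ 2 * E) * ((s ^+ 2 - s0 ^+ 2) / s ^+ 2)
    + 2 * d * (y * E) + d ^+ 2 * E) / 2 / s0 ^+ 2.
  rewrite /v /u (_ : x - t0 = y + d); last by rewrite /y /d; ring.
  by rewrite -/y; field; rewrite !gt_eqF.
rewrite ler_pM2r ?invr_gt0 ?exprn_gt0// ler_pdivrMr//.
have t1 : (y ^+ 2 * E) * ((s ^+ 2 - s0 ^+ 2) / s ^+ 2) <= 2 * `|s ^+ 2 - s0 ^+ 2|.
  apply: (@le_trans _ _ (y ^+ 2 * E * (`|s ^+ 2 - s0 ^+ 2| / s ^+ 2))).
    apply: ler_wpM2l; first by apply: mulr_ge0 => //; exact: sqr_ge0.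
    by apply: ler_wpM2r; [rewrite invr_ge0 sqr_ge0|exact: ler_norm].
  rewrite mulrA ler_pdivrMr ?exprn_gt0//.
  have := @ler_wpM2r _ `|s ^+ 2 - s0 ^+ 2| (normr_ge0 _) _ _ y2E; nra.
have t2 : 2 * d * (y * E) <= 3 * s * `|d|.
  apply: (@le_trans _ _ (2 * `|d| * (`|y| * E))).
    have : d * y <= `|d| * `|y| by rewrite -normrM ler_norm.
    by move/(ler_wpM2r E0); lra.
  have := @ler_wpM2r _ `|d| (normr_ge0 _) _ _ yE; lra.
have t3 : d ^+ 2 * E <= `|d| ^+ 2.
  by rewrite real_normK ?num_real// ler_piMr// sqr_ge0.
rewrite -/d; lra.
Qed.

Lemma normal_pdf_param_lipschitz (t s t0 s0 e x : R) : 0 < s0 ->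
  `|s - s0| <= e -> `|t - t0| <= e -> e <= s0 / 2 ->
  `|normal_pdf t s x - normal_pdf t0 s0 x| <= 22 * e / s0 ^+ 2.
Proof.
move=> s0p se te es.
have /andP[sl su] : s0 - e <= s <= s0 + e by move: se; rewrite ler_distl.
have sp : 0 < s by lra.
have s2 : s0 / 2 <= s by lra.
have e0 : 0 <= e by exact: le_trans te.
rewrite !normal_pdfE ?gt_eqF// /normal_fun.
set E := expR _; set E0 := expR _.
(* The constant comes from the direction [r2], which divides by s^2 >= s0^2 / 4: four times 17/4,
   rounded up. The peak adds 2 more. *)
have EE : `|E - E0| <= 20 * e / s0.
  have ss : `|s ^+ 2 - s0 ^+ 2| <= 5 / 2 * s0 * e.
    rewrite subr_sqr normrM [`|s + s0|]ger0_norm; last lra.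
    have := @ler_wpM2r _ (s + s0) _ _ _ se; nra.
  have dd : `|t - t0| ^+ 2 <= e * (s0 / 2).
    by rewrite expr2 ler_pM// (le_trans te).
  have r1 : E - E0 <= 20 * e / s0.
    apply: (le_trans (gauss_sub_le _ _ _ sp s0p)).
    rewrite (_ : 20 * e / s0 = 20 * e * s0 / s0 ^+ 2); last first.
      by field; rewrite gt_eqF.
    rewrite ler_pM2r ?invr_gt0 ?exprn_gt0//.
    have := @ler_pM _ s (s0 + e) `|t - t0| e (ltW sp) (normr_ge0 _) su te.
    nra.
  have r2 : E0 - E <= 20 * e / s0.
    apply: (le_trans (gauss_sub_le _ _ _ s0p sp)).
    rewrite distrC [`|t0 - t|]distrC ler_pdivrMr ?exprn_gt0//.
    have s4 : s0 ^+ 2 / 4 <= s ^+ 2.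
      rewrite (_ : s0 ^+ 2 / 4 = (s0 / 2) ^+ 2); last by field.
      by rewrite lerXn2r// ?nnegrE//; lra.
    apply: (@le_trans _ _ (20 * e / s0 * (s0 ^+ 2 / 4))); last first.
      by rewrite ler_wpM2l// divr_ge0 ?mulr_ge0// ltW.
    rewrite (_ : 20 * e / s0 * (s0 ^+ 2 / 4) = 5 * e * s0); last first.
      by field; rewrite gt_eqF.
    have := @ler_wpM2l _ s0 (ltW s0p) _ _ te; nra.
  by rewrite ler_norml; lra.
have pp : `|normal_peak s - normal_peak s0| <= 2 * e / s0 ^+ 2.
  apply: (le_trans (normal_peak_sub sp s0p)).
  rewrite ler_pdivrMr ?mulr_gt0// (le_trans se)//.
  rewrite (_ : 2 * e / s0 ^+ 2 * (s * s0) = e * (s / (s0 / 2))); last first.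
    by field; rewrite gt_eqF.
  by rewrite ler_peMr// ler_pdivlMr ?mul1r// divr_gt0.
have EE1 : 0 <= E <= 1.
  rewrite /E expR_ge0/= -expR0 ler_expR mulNr oppr_le0 divr_ge0 ?sqr_ge0//.
  by rewrite mulrn_wge0// sqr_ge0.
have -> : normal_peak s * E - normal_peak s0 * E0 =
    (normal_peak s - normal_peak s0) * E + normal_peak s0 * (E - E0) by ring.
apply: (le_trans (ler_normD _ _)); rewrite !normrM.
rewrite (ger0_norm (normal_peak_ge0 _)) (_ : 22 * e / s0 ^+ 2 =
   2 * e / s0 ^+ 2 * 1 + s0^-1 * (20 * e / s0)); last first.
  by field; rewrite gt_eqF.
apply: lerD; apply: ler_pM => //; rewrite ?normal_peak_ge0//.
  by case/andP: EE1 => ? ?; rewrite ger0_norm.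
exact: normal_peak_le_inv.
Qed.

(** Uniformity in [x] matters twice: a convergent component is compared with its limit at all
    observations at once, and rational parameters must approximate [f0] on the whole line. *)
Lemma weighted_normal_pdf_param_continuous (a0 t0 s0 e : R) : 0 < s0 -> 0 < e ->
  exists2 eta, 0 < eta & forall a t s, `|a - a0| <= eta -> `|t - t0| <= eta ->
    `|s - s0| <= eta ->
    0 < s /\ forall x, `|a * normal_pdf t s x - a0 * normal_pdf t0 s0 x| <= e.
Proof.
move=> s0p e0; pose K := 2 / s0 + `|a0| * (22 / s0 ^+ 2) + 1.
have K0 : 0 < K.
  rewrite /K ltr_wpDl// addr_ge0 ?divr_ge0 ?(ltW s0p)//.
  by rewrite mulr_ge0// divr_ge0// exprn_ge0// ltW.
exists (Num.min (s0 / 2) (e / K)); first by rewrite lt_min !divr_gt0.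
set eta := Num.min _ _ => a t s aa tt ss.
have e1 : eta <= s0 / 2 by rewrite ge_min lexx.
have e2 : eta <= e / K by rewrite ge_min lexx orbT.
have sl : s0 / 2 <= s by move: ss; rewrite ler_distl => /andP[]; lra.
have sp : 0 < s by rewrite (lt_le_trans _ sl)// divr_gt0.
split=> // x.
have -> : a * normal_pdf t s x - a0 * normal_pdf t0 s0 x = (a - a0) * normal_pdf t s x
    + a0 * (normal_pdf t s x - normal_pdf t0 s0 x) by ring.
apply: (le_trans (ler_normD _ _)); rewrite !normrM.
apply: (@le_trans _ _ (eta * (2 / s0) + `|a0| * (22 * eta / s0 ^+ 2))).
  apply: lerD.
    apply: ler_pM => //; rewrite ger0_norm ?normal_pdf_ge0//.
    rewrite (le_trans (normal_pdf_le_inv _ _ sp))//.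
    by rewrite -[leRHS]invf_div lef_pV2// posrE divr_gt0.
  by rewrite ler_wpM2l// normal_pdf_param_lipschitz.
apply: (@le_trans _ _ (eta * K)); last first.
  by rewrite -ler_pdivlMr.
have eta0 : 0 <= eta by exact: le_trans aa.
by rewrite /K; nra.
Qed.

(** Halving the exponent doubles the variance, so the square root is again a multiple of a normal
    density. Integrability of sqrt f rests on this. *)
Lemma sqrt_normal_pdf m s x : 0 < s -> Num.sqrt (normal_pdf m s x) =
  Num.sqrt (normal_peak s) / normal_peak (Num.sqrt 2 * s) *
    normal_pdf m (Num.sqrt 2 * s) x.
Proof.
move=> s0; have s2 : 0 < Num.sqrt 2 * s by rewrite mulr_gt0// sqrtr_gt0.
rewrite !normal_pdfE ?gt_eqF// mulrA divfK; last first.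
  by rewrite gt_eqF// normal_peak_gt0// gt_eqF.
rewrite sqrtrM ?normal_peak_ge0//; congr (_ * _); rewrite /normal_fun.
rewrite exprMn sqr_sqrtr//.
set u := expR _; set v := expR _.
suff -> : u = v ^+ 2 by rewrite sqrtr_sqr ger0_norm// expR_ge0.
rewrite /u /v -expRM_natl; congr expR; field.
by rewrite gt_eqF.
Qed.
End normal_pdf_bounds.

(** * The affinity int h^(1/4) f^(3/4) *)

Section fourth_root.
Context {R : realType}.
Implicit Types a b x : R.

Definition root4 x : R := Num.sqrt (Num.sqrt x).

Lemma root4_ge0 x : 0 <= root4 x. Proof. exact: sqrtr_ge0. Qed.

Lemma root4_gt0 x : (0 < root4 x) = (0 < x).
Proof. by rewrite /root4 !sqrtr_gt0. Qed.

Lemma sqr_root4 x : root4 x ^+ 2 = Num.sqrt x.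
Proof. by rewrite sqr_sqrtr ?sqrtr_ge0. Qed.

Lemma root4X4 x : 0 <= x -> root4 x ^+ 4 = x.
Proof. by move=> x0; rewrite (exprM _ 2 2) sqr_root4 sqr_sqrtr. Qed.

Lemma ler_root4 a b : a <= b -> root4 a <= root4 b.
Proof. by move=> ab; rewrite !ler_wsqrtr. Qed.

Lemma root4M a b : 0 <= a -> root4 (a * b) = root4 a * root4 b.
Proof. by move=> a0; rewrite /root4 !sqrtrM ?sqrtr_ge0. Qed.

Lemma sqrtrD_le a b : 0 <= a -> 0 <= b ->
  Num.sqrt (a + b) <= Num.sqrt a + Num.sqrt b.
Proof.
move=> a0 b0; rewrite -(@ler_pXn2r _ 2) ?nnegrE ?addr_ge0 ?sqrtr_ge0//.
rewrite sqr_sqrtr ?addr_ge0// sqrrD !sqr_sqrtr// addrAC lerDl.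
by rewrite mulrn_wge0// mulr_ge0 ?sqrtr_ge0.
Qed.

Lemma root4D_le a b : 0 <= a -> 0 <= b -> root4 (a + b) <= root4 a + root4 b.
Proof.
move=> a0 b0; rewrite /root4 (le_trans (ler_wsqrtr (sqrtrD_le a0 b0)))//.
by rewrite sqrtrD_le ?sqrtr_ge0.
Qed.

Lemma ln_le_root4 x : 0 < x -> ln x <= 4 * (root4 x - 1).
Proof.
move=> x0; have r0 : 0 < root4 x by rewrite root4_gt0.
rewrite -{1}(root4X4 (ltW x0)) lnXn// -[leLHS]mulr_natl ler_wpM2l//.
by rewrite -{1}[root4 x](subrKC 1) le_ln1Dx//; lra.
Qed.

Lemma root4_continuous : continuous root4.
Proof.
by move=> x; apply: (@continuous_comp _ _ _ Num.sqrt Num.sqrt);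
  exact: sqrt_continuous.
Qed.

(* Weighted AM-GM for a^(1/4) b^(3/4), with a lower bound on its defect. *)
Lemma root4_affinity_defect a b : 0 <= a -> 0 < b ->
  root4 (a / b) * b + (Num.sqrt a - Num.sqrt b) ^+ 2 / 4 <= a / 4 + 3 * b / 4.
Proof.
move=> a0 b0; set B := Num.sqrt b; set r := root4 (a / b).
have bE : b = B ^+ 2 by rewrite sqr_sqrtr// ltW.
have B0 : 0 < B by rewrite sqrtr_gt0.
have aE : a = r ^+ 4 * B ^+ 2.
  by rewrite root4X4 ?divr_ge0 ?(ltW b0)// -bE divfK// gt_eqF.
have AE : Num.sqrt a = r ^+ 2 * B.
  rewrite aE (exprM _ 2 2) -exprMn sqrtr_sqr ger0_norm// mulr_ge0 ?sqr_ge0//.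
  exact: ltW.
rewrite AE -subr_ge0.
(* In terms of [r] and [B] the quartic terms cancel and a square remains. *)
have -> : a / 4 + 3 * b / 4 - (r * b + (r ^+ 2 * B - B) ^+ 2 / 4) =
    B ^+ 2 * (r - 1) ^+ 2 / 2 by rewrite [in LHS]aE [in LHS]bE; field.
by rewrite divr_ge0// mulr_ge0 ?sqr_ge0.
Qed.
End fourth_root.

Section affinity.
Context {R : realType}.
Notation mu := (@lebesgue_measure R).
Variables (f : R -> R) (M : R).
Hypotheses (f_cont : continuous f) (f_gt0 : forall x, 0 < f x)
  (f_int : (\int[mu]_x (f x)%:E = 1)%E) (f_le : forall x, f x <= M)
  (sqrtf_int : (\int[mu]_x (Num.sqrt (f x))%:E < +oo)%E).

Let fne x : f x != 0. Proof. by rewrite gt_eqF. Qed.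

Lemma root4_ratio_continuous (h : R -> R) (e : R) : continuous h ->
  continuous (fun x => root4 ((h x + e) / f x)).
Proof.
move=> ch x; apply: (@continuous_comp _ _ _ (fun x => (h x + e) / f x) root4).
  apply: (@cvgM R); last by apply: cvgV => //; exact: f_cont.
  by apply: (@cvgD R R^o); [exact: ch|exact: cvg_cst].
exact: root4_continuous.
Qed.

Lemma measurable_sqrt_density : measurable_fun setT (fun x => Num.sqrt (f x)).
Proof.
apply: continuous_measurable_fun => x.
by apply: (@continuous_comp _ _ _ f Num.sqrt); [exact: f_cont|exact: sqrt_continuous].
Qed.

(** Squaring the test and multiplying by f leaves sqrt ((h + e) f) <= sqrt (H + e) sqrt f. A square
    root in place of the fourth root would leave h + e, whose integral is infinite for e > 0. *)
Lemma root4_ratio_square_integrable (h : R -> R) (e H : R) : continuous h ->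
  (forall x, 0 <= h x <= H) -> 0 <= e ->
  (\int[mu]_x (root4 ((h x + e) / f x) ^+ 2 * f x)%:E < +oo)%E.
Proof.
move=> ch hH e0.
have he x : 0 <= h x + e by case/andP: (hH x) => ? _; rewrite addr_ge0.
apply: (@le_lt_trans _ _
    (\int[mu]_x ((Num.sqrt (H + e))%:E * (Num.sqrt (f x))%:E)%E)%E).
  apply: ge0_le_integral => //.
  - by move=> x _; rewrite lee_fin mulr_ge0 ?sqr_ge0// ltW.
  - apply/measurable_EFinP; apply: measurable_funM.
      apply: measurable_funX; apply: continuous_measurable_fun.
      exact: root4_ratio_continuous.
    exact: continuous_measurable_fun.
  - apply: emeasurable_funM => //; apply/measurable_EFinP.
    exact: measurable_sqrt_density.
  move=> x _; rewrite -EFinM lee_fin sqr_root4 sqrtrM//.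
  rewrite -mulrA (_ : Num.sqrt (f x)^-1 * f x = Num.sqrt (f x)); last first.
    rewrite -{2}[f x]sqr_sqrtr ?(ltW (f_gt0 x))// sqrtrV ?(ltW (f_gt0 x))//.
    by rewrite expr2 mulKf// gt_eqF// sqrtr_gt0.
  rewrite ler_wpM2r ?sqrtr_ge0// ler_wsqrtr// lerD2r.
  by case/andP: (hH x).
rewrite ge0_integralZl_EFin ?sqrtr_ge0//; last first.
  by apply/measurable_EFinP; exact: measurable_sqrt_density.
by rewrite lte_mul_pinfty// lee_fin sqrtr_ge0.
Qed.

Variable h0 : R -> R.
Hypotheses (h0_cont : continuous h0) (h0_ge0 : forall x, 0 <= h0 x)
  (h0_int : (\int[mu]_x (h0 x)%:E <= 1)%E).

Let I : R := fine (\int[mu]_x (Num.sqrt (f x))%:E)%E.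

Let IE : (\int[mu]_x (Num.sqrt (f x))%:E = I%:E)%E.
Proof.
rewrite fineK// ge0_fin_numE//; apply: integral_ge0 => x _.
by rewrite lee_fin sqrtr_ge0.
Qed.

Let measurable_affinity (h : R -> R) e : continuous h ->
  measurable_fun setT (fun x => root4 ((h x + e) / f x) * f x).
Proof.
move=> ch; apply: measurable_funM; last exact: continuous_measurable_fun.
by apply: continuous_measurable_fun; exact: root4_ratio_continuous.
Qed.

(** The fourth root is subadditive, and the total excess of h + e over [h0] is at most 2 e. Its
    contribution is root4 (2 e) f^(3/4), where f^(3/4) <= root4 M sqrt f is integrable. *)
Lemma affinity_perturbation_le (h : R -> R) (e : R) : continuous h ->
  (forall x, 0 <= h x <= h0 x + e) -> 0 <= e ->
  (\int[mu]_x (root4 ((h x + e) / f x) * f x)%:E <=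
   \int[mu]_x (root4 ((h0 x + 0) / f x) * f x)%:E + (root4 (2 * e) * root4 M * I)%:E)%E.
Proof.
move=> ch hh e0.
have msq : measurable_fun setT (fun x => (Num.sqrt (f x))%:E).
  by apply/measurable_EFinP; exact: measurable_sqrt_density.
rewrite [X in (_ + X)%E]EFinM -IE -ge0_integralZl_EFin//; last first.
  by rewrite mulr_ge0 ?root4_ge0.
rewrite -ge0_integralD//; last 4 first.
- by move=> x _; rewrite lee_fin mulr_ge0 ?root4_ge0// ltW.
- by apply/measurable_EFinP; exact: measurable_affinity.
- by move=> x _; rewrite mule_ge0// lee_fin ?sqrtr_ge0// mulr_ge0 ?root4_ge0.
- exact: emeasurable_funM.
apply: ge0_le_integral => //.
- by move=> x _; rewrite lee_fin mulr_ge0 ?root4_ge0// ltW.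
- by apply/measurable_EFinP; exact: measurable_affinity.
- apply: emeasurable_funD; last exact: emeasurable_funM.
  by apply/measurable_EFinP; exact: measurable_affinity.
move=> x _; rewrite -EFinM -EFinD lee_fin addr0.
have /andP[hx0 hx1] := hh x; have fx := f_gt0 x; have fx' := ltW fx.
have step1 : root4 ((h x + e) / f x) <= root4 (h0 x / f x) + root4 (2 * e / f x).
  rewrite (le_trans _ (root4D_le _ _)) ?divr_ge0 ?mulr_ge0//.
  by apply: ler_root4; rewrite -mulrDl ler_pM2r ?invr_gt0//; lra.
apply: (@le_trans _ _ ((root4 (h0 x / f x) + root4 (2 * e / f x)) * f x)).
  by rewrite ler_wpM2r.
rewrite mulrDl lerD2l root4M ?mulr_ge0// -!mulrA ler_wpM2l ?root4_ge0//.
have rf0 : root4 (f x) != 0 by rewrite gt_eqF// root4_gt0.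
have -> : root4 (f x)^-1 * f x = root4 (f x) * Num.sqrt (f x).
  apply: (mulfI rf0); rewrite mulrA -root4M// mulfV// /root4 !sqrtr1 mul1r.
  by rewrite mulrA -expr2 -/(root4 _) sqr_root4 -expr2 sqr_sqrtr.
by rewrite ler_wpM2r ?sqrtr_ge0// ler_root4.
Qed.

(** Integrating the AM-GM inequality bounds affinity plus defect by 1/4 + 3/4, so an affinity of 1
    forces the integral of the defect to be 0. *)
Lemma affinity_ge1_eq : (1 <= \int[mu]_x (root4 ((h0 x + 0) / f x) * f x)%:E)%E ->
  forall x, h0 x = f x.
Proof.
move=> aff.
pose D x := (Num.sqrt (h0 x) - Num.sqrt (f x)) ^+ 2 / 4.
have D0 x : 0 <= D x by rewrite divr_ge0// sqr_ge0.
have cD : continuous D.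
  move=> x; apply: (@cvgM R); last exact: cvg_cst.
  apply: (@continuous_comp _ _ _ (fun x => Num.sqrt (h0 x) - Num.sqrt (f x))
    (fun y => y ^+ 2)); last exact: exprn_continuous.
  apply: (@cvgB R R^o).
    by apply: (@continuous_comp _ _ _ h0 Num.sqrt); [exact: h0_cont|exact: sqrt_continuous].
  by apply: (@continuous_comp _ _ _ f Num.sqrt); [exact: f_cont|exact: sqrt_continuous].
have mD : measurable_fun setT (EFin \o D).
  by apply/measurable_EFinP; exact: continuous_measurable_fun.
have mh0 : measurable_fun setT (EFin \o h0).
  by apply/measurable_EFinP; exact: continuous_measurable_fun.
have mf : measurable_fun setT (EFin \o f).
  by apply/measurable_EFinP; exact: continuous_measurable_fun.
have f0 x : 0 <= f x by exact: ltW.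
have maff : measurable_fun setT (fun x => (root4 ((h0 x + 0) / f x) * f x)%:E).
  by apply/measurable_EFinP; exact: measurable_affinity.
have le1 : (\int[mu]_x (root4 ((h0 x + 0) / f x) * f x)%:E + \int[mu]_x (D x)%:E <= 1)%E.
  rewrite -ge0_integralD//; last 2 first.
  - by move=> x _; rewrite lee_fin mulr_ge0 ?root4_ge0.
  - by move=> x _; rewrite lee_fin.
  apply: (@le_trans _ _ (\int[mu]_x ((4^-1)%:E * (h0 x)%:E + (3 / 4)%:E * (f x)%:E)%E)%E).
    apply: ge0_le_integral => //.
    - by move=> x _; rewrite -EFinD lee_fin addr_ge0// mulr_ge0 ?root4_ge0.
    - exact: emeasurable_funD.
    - by apply: emeasurable_funD; exact: emeasurable_funM.
    move=> x _; rewrite -!EFinM -!EFinD lee_fin addr0.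
    rewrite (le_trans (root4_affinity_defect (h0_ge0 x) (f_gt0 x)))//; lra.
  rewrite ge0_integralD//; last 4 first.
  - by move=> x _; rewrite -EFinM lee_fin mulr_ge0.
  - exact: emeasurable_funM.
  - by move=> x _; rewrite -EFinM lee_fin mulr_ge0.
  - exact: emeasurable_funM.
  rewrite !ge0_integralZl_EFin//; last 2 first.
  - by move=> x _; rewrite lee_fin.
  - by move=> x _; rewrite lee_fin.
  rewrite f_int mule1.
  apply: (@le_trans _ _ ((4^-1)%:E * 1 + (3 / 4)%:E)%E).
    by rewrite leeD2r// lee_wpmul2l// lee_fin.
  by rewrite mule1 -EFinD lee_fin; lra.
have intD0 : (\int[mu]_x `|(EFin \o D) x| = 0)%E.
  under eq_integral do rewrite gee0_abs ?lee_fin//.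
  apply/eqP; rewrite eq_le; apply/andP; split; last first.
    by apply: integral_ge0 => x _; rewrite lee_fin.
  rewrite -(@leeD2lE _ 1%E)// adde0; apply: le_trans le1.
  by rewrite leeD2r.
have /ae_eq_integral_abs [] // := intD0.
move=> N [mN N0 subN] x.
apply/eqP/negP => /negP h0f.
have Dx : 0 < D x.
  rewrite divr_gt0// lt_def sqr_ge0 sqrf_eq0 subr_eq0 andbT.
  apply: contra h0f => /eqP eqs.
  by rewrite -(sqr_sqrtr (h0_ge0 x)) -(sqr_sqrtr (f0 x)) eqs.
(* By continuity the defect would be nonzero on a whole ball, which has positive measure, whereas it
   vanishes almost everywhere. *)
have := cD x; move/cvgrPdist_lt => /(_ _ Dx)/nbhs_ballP[r /= r0 rD].
have : (mu (ball x r) <= mu N)%E.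
  apply: le_measure; rewrite ?inE//; first exact: measurable_ball.
  move=> y /rD /= Dy; apply: subN => /= /(_ Logic.I) D0y.
  by move: Dy; case: D0y => ->; rewrite subr0 ger0_norm// ltxx.
rewrite N0 lebesgue_measure_ball ?(ltW r0)// lee_fin leNgt.
by rewrite pmulrn_lgt0 ?r0.
Qed.

(** Only an upper bound of [h] by [h0] is asked for, and [h] may change with [e]: this leaves room
    for rational approximations of [h0]. *)
Lemma density_eq_of_affinity_ge1 :
  (forall e : R, 0 < e -> exists h : R -> R, [/\ continuous h,
     forall x, 0 <= h x <= h0 x + e &
     (1 <= \int[mu]_x (root4 ((h x + e) / f x) * f x)%:E)%E]) ->
  forall x, h0 x = f x.
Proof.
move=> H; apply: affinity_ge1_eq; apply/lee_addgt0Pr => k k0.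
have I0' : 0 <= I.
  by rewrite /I fine_ge0// integral_ge0// => x _; rewrite lee_fin sqrtr_ge0.
pose c := root4 M * I + 1.
have c0 : 0 < c by rewrite /c ltr_wpDl// mulr_ge0// root4_ge0.
have kc : 0 < k / c by rewrite divr_gt0.
(* Chosen so that root4 (2 e) = k / c. *)
pose e := (k / c) ^+ 4 / 2.
have e0 : 0 < e by rewrite divr_gt0// exprn_gt0.
have [h [ch hh h1]] := H e e0.
rewrite (le_trans h1)// (le_trans (affinity_perturbation_le ch hh (ltW e0)))//.
rewrite leeD2l// lee_fin.
have -> : root4 (2 * e) = k / c.
  have -> : 2 * e = (k / c) ^+ 4 by rewrite /e; field; rewrite gt_eqF.
  rewrite /root4 (exprM _ 2 2) sqrtr_sqr ger0_norm ?sqr_ge0//.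
  by rewrite sqrtr_sqr ger0_norm// ltW.
rewrite -mulrA mulrAC ler_pdivrMr// ler_wpM2l// ?(ltW k0)//.
by rewrite /c lerDl.
Qed.
End affinity.

(** * Finite sums of normal densities *)

Section normal_sums.
Context {R : realType} {m : nat}.
Implicit Types a t s : 'I_m -> R.
Notation mu := (@lebesgue_measure R).

Definition normal_sum a t s (x : R) : R :=
  \sum_(j < m) a j * normal_pdf (t j) (s j) x.

Lemma normal_sum_ge0 a t s x : (forall j, 0 <= a j) -> 0 <= normal_sum a t s x.
Proof. by move=> a0; apply: sumr_ge0 => j _; rewrite mulr_ge0// normal_pdf_ge0. Qed.

Lemma normal_sum_continuous a t s : (forall j, 0 < s j) -> continuous (normal_sum a t s).
Proof.
move=> s0 x; rewrite /normal_sum.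
have h (r : seq 'I_m) : {for x, continuous
    (fun x => \sum_(j <- r) a j * normal_pdf (t j) (s j) x)}.
  elim: r => [|j r IH].
    rewrite (_ : (fun _ => _) = cst 0); first exact: cvg_cst.
    by apply/funext => y; rewrite big_nil.
  rewrite (_ : (fun _ => _) = (fun y => a j * normal_pdf (t j) (s j) y +
    \sum_(i <- r) a i * normal_pdf (t i) (s i) y)); last first.
    by apply/funext => y; rewrite big_cons.
  apply: (@cvgD R R^o) => //; apply: (@cvgM R); first exact: cvg_cst.
  by apply: continuous_normal_pdf; rewrite gt_eqF.
exact: h.
Qed.

Lemma normal_sum_le a t s x : (forall j, 0 <= a j) -> (forall j, 0 < s j) ->
  normal_sum a t s x <= \sum_(j < m) a j / s j.
Proof.
move=> a0 s0; apply: ler_sum => j _; rewrite ler_wpM2l//.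
exact: normal_pdf_le_inv.
Qed.

Lemma integral_normal_sum a t s : (forall j, 0 <= a j) ->
  (\int[mu]_x (normal_sum a t s x)%:E = (\sum_(j < m) a j)%:E)%E.
Proof.
move=> a0; under eq_integral => x _ do rewrite /normal_sum -sumEFin.
rewrite (@ge0_integral_sum _ _ _ mu _ _ _
   (fun j x => (a j * normal_pdf (t j) (s j) x)%:E))//; last 2 first.
- move=> j; apply/measurable_EFinP; apply: measurable_funM => //.
  exact: measurable_normal_pdf.
- by move=> j x _; rewrite lee_fin mulr_ge0// normal_pdf_ge0.
rewrite -sumEFin; apply: eq_bigr => j _.
under eq_integral => x _ do rewrite EFinM.
rewrite ge0_integralZl_EFin//; last 2 first.
- by move=> x _; rewrite lee_fin normal_pdf_ge0.
- by apply/measurable_EFinP; exact: measurable_normal_pdf.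
by rewrite integral_normal_pdf mule1.
Qed.

Lemma normal_sum_vanishes a t s e : (forall j, 0 <= a j) -> (forall j, 0 < s j) ->
  0 < e -> exists T, forall x, T < `|x| -> normal_sum a t s x <= e.
Proof.
move=> a0 s0 e0.
(* The distance at which [normal_pdf_far_le] makes the weighted component at most e / (m+1); [m.+1]
   avoids a division by 0 when [m] is 0. *)
pose W j := 1 + 2 * s j * (a j * m.+1%:R / e).
have W1 j : 1 <= W j.
  rewrite /W lerDl mulr_ge0//; first by rewrite mulr_ge0// ltW.
  by rewrite divr_ge0 ?(ltW e0)// mulr_ge0.
exists (\sum_(j < m) (`|t j| + W j)) => x xT.
have each j : a j * normal_pdf (t j) (s j) x <= e / m.+1%:R.
  have W0 : 0 < W j by exact: lt_le_trans (W1 j).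
  have wx : W j <= `|x - t j|.
    have : `|t j| + W j <= `|x|.
      apply: le_trans (ltW xT); rewrite (bigD1 j)//= lerDl.
      by apply: sumr_ge0 => i _; rewrite addr_ge0// (le_trans ler01).
    have := ler_normD (x - t j) (t j); rewrite subrK; lra.
  have fe := normal_pdf_far_le (s0 j) (W1 j) wx.
  apply: (@le_trans _ _ (a j * (2 * s j / W j))); first by rewrite ler_wpM2l.
  rewrite mulrA ler_pdivrMr// mulrAC ler_pdivlMr ?ltr0n//.
  apply: (@le_trans _ _ (e * (2 * s j * (a j * m.+1%:R / e)))).
    rewrite le_eqVlt; apply/orP; left; apply/eqP; field; rewrite gt_eqF//.
  by rewrite ler_wpM2l ?(ltW e0)// /W lerDr.
rewrite /normal_sum (le_trans (ler_sum _ (fun j _ => each j)))//.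
rewrite sumr_const card_ord -[leLHS]mulr_natl mulrA [_ * e]mulrC -mulrA ler_piMr ?(ltW e0)//.
by rewrite ler_pdivrMr ?ltr0n// mul1r ler_nat.
Qed.

Lemma sqrtr_sum_le (u : 'I_m -> R) : (forall j, 0 <= u j) ->
  Num.sqrt (\sum_(j < m) u j) <= \sum_(j < m) Num.sqrt (u j).
Proof.
move=> u0; have : 0 <= \sum_(j < m) u j /\
    Num.sqrt (\sum_(j < m) u j) <= \sum_(j < m) Num.sqrt (u j).
  elim/big_rec2: _ => [|j y1 y2 _ [h1 h2]]; first by rewrite sqrtr0.
  split; first by rewrite addr_ge0.
  by rewrite (le_trans (sqrtrD_le _ _))// lerD2l.
by case.
Qed.

Lemma integral_sqrt_normal_sum a t s : (forall j, 0 <= a j) -> (forall j, 0 < s j) ->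
  (\int[mu]_x (Num.sqrt (normal_sum a t s x))%:E < +oo)%E.
Proof.
move=> a0 s0; pose s' j := Num.sqrt 2 * s j.
have s'0 j : 0 < s' j by rewrite mulr_gt0// sqrtr_gt0.
pose b j := Num.sqrt (a j) * (Num.sqrt (normal_peak (s j)) / normal_peak (s' j)).
have b0 j : 0 <= b j.
  by rewrite mulr_ge0 ?sqrtr_ge0// divr_ge0 ?sqrtr_ge0 ?normal_peak_ge0.
apply: (@le_lt_trans _ _ (\int[mu]_x (normal_sum b t s' x)%:E)%E); last first.
  by rewrite integral_normal_sum// ltry.
apply: ge0_le_integral => //.
- apply/measurable_EFinP; apply: continuous_measurable_fun => x.
  apply: (@continuous_comp _ _ _ (normal_sum a t s) Num.sqrt).
    exact: normal_sum_continuous.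
  exact: sqrt_continuous.
- apply/measurable_EFinP; apply: continuous_measurable_fun.
  exact: normal_sum_continuous.
move=> x _; rewrite lee_fin (le_trans (sqrtr_sum_le _))//.
  by move=> j; rewrite mulr_ge0// normal_pdf_ge0.
apply: ler_sum => j _; rewrite sqrtrM// sqrt_normal_pdf//.
by rewrite /b -!mulrA.
Qed.
End normal_sums.

(** * Identifiability *)

Section identifiability.
Context {R : realType}.
Implicit Types (v w : R * R) (C : R * R -> R).

Let pdf v x : R := normal_pdf v.1 v.2 x.

(* The density with parameters [v = (mean, sd)] is the larger one near +oo. *)
Let dominates v w := (w.2 < v.2) || (w.2 == v.2) && (w.1 < v.1).

Lemma gauss_exponent_diverges (v w : R * R) (K : R) : 0 < v.2 -> 0 < w.2 ->
  dominates v w -> exists X, forall x, X <= x ->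
  K <= (x - w.1) ^+ 2 / (w.2 ^+ 2 *+ 2) - (x - v.1) ^+ 2 / (v.2 ^+ 2 *+ 2).
Proof.
case: v w => [tv sv] [tw sw] /= v0 w0; rewrite /dominates /=.
rewrite -(mulr_natr (sw ^+ 2)) -(mulr_natr (sv ^+ 2)).
case/orP => [sl|/andP[/eqP -> tl]].
  pose p := (sw ^+ 2 * 2)^-1; pose r := (sv ^+ 2 * 2)^-1; pose d := tw - tv.
  have r0 : 0 < r by rewrite invr_gt0 mulr_gt0// exprn_gt0.
  have pr : 0 < p - r.
    rewrite subr_gt0 /p /r ltf_pV2 ?posrE ?mulr_gt0 ?exprn_gt0//.
    by rewrite ltr_pM2r// ltrXn2r ?nnegrE ?ltW.
  (* With u = x - tw, the first term ensures u (p - r) >= 1 + 2 r |d|: the part 2 r |d| cancels the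
     cross term of (u + d)^2, and the 1 leaves u, which the second term makes at least |K| + r
     d^2. *)
  exists (tw + ((1 + 2 * r * `|d|) / (p - r) + (`|K| + r * d ^+ 2))) => x xX.
  rewrite -/p -/r (_ : x - tv = (x - tw) + d); last by rewrite /d; ring.
  set u := x - tw.
  have d0 : 0 <= r * d ^+ 2 by rewrite mulr_ge0 ?sqr_ge0// ltW.
  have q0 : 0 <= (1 + 2 * r * `|d|) / (p - r).
    by rewrite divr_ge0 ?(ltW pr)// addr_ge0// !mulr_ge0// ltW.
  have K0 : 0 <= `|K| by [].
  have u1 : (1 + 2 * r * `|d|) / (p - r) <= u by rewrite /u; lra.
  have u2 : `|K| + r * d ^+ 2 <= u by rewrite /u; lra.
  have u0 : 0 <= u by lra.
  rewrite ler_pdivrMr// in u1.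
  have u3 := @ler_wpM2l _ u u0 _ _ u1.
  have du : d * u <= `|d| * u by rewrite ler_wpM2r// ler_norm.
  have du' := @ler_wpM2l _ r (ltW r0) _ _ du.
  apply: (le_trans (ler_norm K)).
  have -> : u ^+ 2 * p - (u + d) ^+ 2 * r =
      u * (u * (p - r)) - 2 * (r * (d * u)) - r * d ^+ 2 by ring.
  by move: u3 du' u2; rewrite mulrDr mulr1; lra.
pose b := sv ^+ 2 * 2; have b0 : 0 < b by rewrite mulr_gt0// exprn_gt0.
exists ((b * K / (tv - tw) + tv + tw) / 2) => x.
rewrite -/b ler_pdivrMr// -mulrBl ler_pdivlMr// => xX.
have h : b * K / (tv - tw) <= 2 * x - tv - tw by lra.
rewrite ler_pdivrMr ?subr_gt0// in h.
by move: h; lra.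
Qed.

Lemma normal_pdf_negligible (v w : R * R) (e : R) : 0 < v.2 -> 0 < w.2 ->
  dominates v w -> 0 < e -> exists X, forall x, X <= x -> pdf w x <= e * pdf v x.
Proof.
move=> v0 w0 vw e0; pose pv := normal_peak v.2; pose pw := normal_peak w.2.
have pv0 : 0 < pv by rewrite normal_peak_gt0// gt_eqF.
have pw0 : 0 < pw by rewrite normal_peak_gt0// gt_eqF.
have [X HX] := gauss_exponent_diverges (- ln (e * pv / pw)) v0 w0 vw.
exists X => x /HX; rewrite /pdf !normal_pdfE ?gt_eqF// /normal_fun -/pv -/pw.
rewrite !mulNr; set b := (x - w.1) ^+ 2 / _; set a := (x - v.1) ^+ 2 / _ => h.
have h1 : expR (- b) <= expR (- a) * (e * pv / pw).
  have lnq : expR (ln (e * pv / pw)) = e * pv / pw.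
    by rewrite lnK// posrE divr_gt0// mulr_gt0.
  by rewrite -lnq -expRD ler_expR; lra.
apply: (le_trans (ler_wpM2l (ltW pw0) h1)).
by rewrite le_eqVlt; apply/orP; left; apply/eqP; field; rewrite gt_eqF.
Qed.

Lemma dominates_max (l : seq (R * R)) : l != [::] -> uniq l ->
  exists2 v, v \in l & forall w, w \in l -> w != v -> dominates v w.
Proof.
elim: l => [//|u l IH] _ /= /andP[ul unl].
have [->|l0] := eqVneq l [::].
  by exists u; rewrite ?mem_head// => w; rewrite inE => /eqP ->; rewrite eqxx.
have [v vl vmax] := IH l0 unl.
have uv : u != v by apply: contraNneq ul => ->.
have [vu|vu] := boolP (dominates v u).
  exists v; first by rewrite inE vl orbT.
  by move=> w; rewrite inE => /orP[/eqP ->//|/vmax].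
have duv : dominates u v.
  move: vu uv; rewrite /dominates -pair_eqE /pair_eq/=.
  by case: (ltgtP u.2 v.2) => //= _; case: (ltgtP u.1 v.1).
exists u; first exact: mem_head.
move=> w; rewrite inE => /orP[/eqP ->|wl]; first by rewrite eqxx.
have [-> //|wv] := eqVneq w v.
have := vmax w wl wv; move: duv; rewrite /dominates => h1 h2 _.
case/orP: h1 => [h1|/andP[/eqP h1 h1']]; case/orP: h2 => [h2|/andP[/eqP h2 h2']].
- by rewrite (lt_trans h2 h1).
- by rewrite h2 h1.
- by rewrite -h1 h2.
- by rewrite h2 h1 eqxx (lt_trans h2' h1') orbT.
Qed.

(** Among the densities with nonzero coefficient one dominates all others near +oo. Far enough to
    the right its term outweighs the rest together, so the sum cannot vanish there. *)
Lemma normal_pdf_free (l : seq (R * R)) C : uniq l ->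
  (forall v, v \in l -> 0 < v.2) ->
  (forall x, \sum_(v <- l) C v * pdf v x = 0) ->
  forall v, v \in l -> C v = 0.
Proof.
move=> ul l0 lC v vl; apply/eqP; apply/negP => /negP Cv.
pose l' := [seq v <- l | C v != 0].
have vl' : v \in l' by rewrite mem_filter Cv.
have l'0 : l' != [::] by apply: contraTneq vl' => ->.
have [u ul' umax] := dominates_max l'0 (filter_uniq _ ul).
have /andP[Cu uL] : (C u != 0) && (u \in l) by move: ul'; rewrite mem_filter.
have u0 := l0 u uL.
have lC' x : C u * pdf u x + \sum_(w <- l' | w != u) C w * pdf w x = 0.
  rewrite -(bigD1_seq u)//= ?filter_uniq//.
  rewrite big_filter -[RHS](lC x) [RHS](bigID (fun w => C w != 0))/=.
  rewrite [X in _ = _ + X]big1 ?addr0// => w.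
  by rewrite negbK => /eqP ->; rewrite mul0r.
pose S := \sum_(w <- l' | w != u) `|C w|.
have S0 : 0 <= S by exact: sumr_ge0.
(* Makes S e < |C u|, also when S = 0. *)
pose e := `|C u| / (S + 1) / 2.
have Cu0 : 0 < `|C u| by rewrite normr_gt0.
have e0 : 0 < e by rewrite !divr_gt0// ltr_wpDl.
have [X HX] : exists X, forall w, w \in l' -> w != u -> forall x, X <= x ->
    pdf w x <= e * pdf u x.
  have : forall w, w \in l' -> w != u -> dominates u w := umax.
  have : forall w, w \in l' -> 0 < w.2.
    by move=> w; rewrite mem_filter => /andP[_]; exact: l0.
  move: (l') => k; elim: k => [|w k IH] kp kd; first by exists 0.
  have [X HX] : exists X, forall w, w \in k -> w != u -> forall x, X <= x ->
    pdf w x <= e * pdf u x.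
    by apply: IH => z zk; [apply: kp|apply: kd]; rewrite inE zk orbT.
  have [wu|wu] := eqVneq w u.
    exists X => z; rewrite inE => /orP[/eqP -> |]; last exact: HX.
    by rewrite wu eqxx.
  have [Y HY] := normal_pdf_negligible u0 (kp w (mem_head _ _))
    (kd w (mem_head _ _) wu) e0.
  exists (Num.max X Y) => z; rewrite inE => /orP[/eqP -> _ x|zk zu x];
    rewrite ge_max => /andP[? ?]; [exact: HY|exact: HX].
have pu0 : 0 < pdf u X by exact: normal_pdf_gt0.
have := lC' X => /eqP; rewrite addr_eq0 => /eqP hC.
have : `|C u| * pdf u X <= S * (e * pdf u X).
  rewrite -{1}(ger0_norm (ltW pu0)) -normrM hC normrN.
  apply: (le_trans (ler_norm_sum _ _ _)).
  rewrite big_seq_cond /S mulr_suml [leRHS]big_seq_cond; apply: ler_sum => w /andP[wl wu].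
  rewrite normrM ler_wpM2l// ger0_norm ?normal_pdf_ge0//; exact: HX.
rewrite mulrA ler_pM2r// leNgt => /negP; apply.
rewrite /e -mulrA mulrCA gtr_pMr// mulrA ltr_pdivrMr//.
by rewrite ltr_pdivrMr ?ltr_wpDl//; lra.
Qed.

(** Components may coincide or carry weight 0, so weights cannot be matched index by index. Only the
    total weight of a set of parameters is determined, and a c.d.f. reads just that. *)
Lemma normal_mixture_identifiable (I : finType) (c : I -> R) (p : I -> R * R) :
  (forall i, 0 < (p i).2) ->
  (forall x, \sum_i c i * pdf (p i) x = 0) ->
  forall Q : pred (R * R), \sum_(i | Q (p i)) c i = 0.
Proof.
move=> p0 cp Q.
pose l := undup [seq p i | i : I].
pose C v := \sum_(i | p i == v) c i.
have sumE (F : R * R -> R) : \sum_(v <- l) C v * F v = \sum_i c i * F (p i).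
  transitivity (\sum_(v <- l) \sum_(i : I) (if p i == v then c i * F (p i) else 0)).
    apply: eq_bigr => v _; rewrite /C mulr_suml big_mkcond/=.
    by apply: eq_bigr => i _; case: eqP => [->|].
  rewrite exchange_big/=; apply: eq_bigr => i _.
  rewrite -big_mkcond/= (eq_bigl (pred1 (p i))); last by move=> v; rewrite eq_sym.
  rewrite -big_filter filter_pred1_uniq ?undup_uniq ?big_seq1//.
  by rewrite mem_undup map_f// mem_enum.
have C0 : forall v, v \in l -> C v = 0.
  apply: normal_pdf_free; first exact: undup_uniq.
    by move=> v; rewrite mem_undup => /mapP[i _ ->].
  by move=> x; rewrite sumE cp.
transitivity (\sum_(v <- l) C v * (Q v)%:R).
  by rewrite sumE big_mkcond/=; apply: eq_bigr => i _; case: (Q _); rewrite ?mulr1 ?mulr0.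
by rewrite big_seq big1// => v /C0 ->; rewrite mul0r.
Qed.
End identifiability.

(** * The distance D_KW *)

Section D_KW_bound.
Context {R : realType}.
Notation mu := (@lebesgue_measure R).

Let k (x : R) : R := expR (- `|x|).

Let k_cont : continuous k.
Proof.
move=> x; apply: (cvg_comp _ expR); last exact: continuous_expR.
by apply: (@cvgN _ R^o); exact: (@norm_continuous _ R^o).
Qed.

Let mk : measurable_fun setT k. Proof. exact: continuous_measurable_fun. Qed.

Lemma integral_exp_abs_le2 : (\int[mu]_x (expR (- `|x|))%:E <= 2%:E)%E.
Proof.
rewrite (@ge0_symfun_integralT _ k)//; last 2 first.
- by move=> x; exact: expR_ge0.
- by move=> x; rewrite /k /= normrN.
rewrite -[leRHS]mule1 lee_wpmul2l//.
rewrite -(@integral_exponential_pdf R 1 ltr01).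
rewrite -set_itvcy.
apply: (@le_trans _ _ (\int[mu]_(x in `[0%R, +oo[) (exponential_pdf 1 x)%:E)%E).
  apply: ge0_le_integral => //.
  - by move=> x _; rewrite lee_fin expR_ge0.
  - by apply/measurable_EFinP; exact: measurable_funTS.
  - apply/measurable_EFinP; apply: measurable_funTS; exact: measurable_exponential_pdf.
  move=> x /=; rewrite in_itv/= andbT => x0.
  by rewrite lee_fin exponential_pdfE//= mul1r mulN1r /k ger0_norm.
apply: ge0_subset_integral => //.
  by apply/measurable_EFinP; exact: measurable_exponential_pdf.
by move=> x _; rewrite lee_fin exponential_pdf_ge0.
Qed.

(** The two quadrant indicators can differ only if [v.1] separates the first thresholds or [v.2] the
    second ones. The resulting strips have widths |t - t'| and |s - s'|. *)
Lemma step_pair_dist (t s t' s' : R) (v : R * R) :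
  `|((t <= v.1) && (s <= v.2))%:R - ((t' <= v.1) && (s' <= v.2))%:R| <=
  \1_`[Num.min t t', Num.max t t'] v.1 + \1_`[Num.min s s', Num.max s s'] v.2 :> R.
Proof.
have h (a a' x : R) : (a <= x) != (a' <= x) -> x \in `[Num.min a a', Num.max a a'].
  rewrite in_itv/= ge_min le_max.
  by case: (leP a x); case: (leP a' x) => //= h1 h2 _; rewrite ?(ltW h1) ?(ltW h2) ?orbT.
have i0 (A : set R) x : 0 <= \1_A x :> R by rewrite indicE.
have [e1|n1] := eqVneq (t <= v.1) (t' <= v.1); last first.
  rewrite [\1__ v.1]indicE mem_set/=; last exact: h.
  apply: (@le_trans _ _ 1); last by rewrite lerDl.
  by case: (_ && _); case: (_ && _);
    rewrite ?subrr ?normr0 ?subr0 ?sub0r ?normrN ?normr1 ?ler01.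
have [e2|n2] := eqVneq (s <= v.2) (s' <= v.2); last first.
  rewrite [\1__ v.2]indicE mem_set/=; last exact: h.
  apply: (@le_trans _ _ 1); last by rewrite lerDr.
  by case: (_ && _); case: (_ && _);
    rewrite ?subrr ?normr0 ?subr0 ?sub0r ?normrN ?normr1 ?ler01.
by rewrite e1 e2 subrr normr0 addr_ge0.
Qed.

Lemma integral_strip (a b : R) :
  (\int[mu]_x (\1_`[Num.min a b, Num.max a b] x)%:E = `|a - b|%:E)%E.
Proof.
rewrite integral_indic//= setIT lebesgue_measure_itv/= lte_fin.
case: ltP => h.
  rewrite -EFinB; congr EFin; case: (leP a b) => ab.
    by rewrite distrC ger0_norm// subr_ge0.
  by rewrite ger0_norm// subr_ge0 ltW.
by congr EFin; case: (leP a b) h => ab h;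
  [rewrite (le_anti (_ : a <= b <= a)) ?subrr ?normr0 ?ab|move: (lt_le_trans ab h); rewrite ltxx].
Qed.

Variable m : nat.
Implicit Types (G : mixing R m) (b t s : 'I_m -> R).

(** [G'] enters through any representation of its c.d.f., because the limits of the estimated
    components describe the truth with labels of their own. The exponential kernel has integral at
    most 2 on the line, hence 4 for a weight gap and 2 for a strip. *)
Lemma D_KW_le G G' b t s : (forall j, 0 <= b j) ->
  (forall v, mixing_cdf G' v = \sum_(j < m | (t j <= v.1) && (s j <= v.2)) b j) ->
  (D_KW G G' <= (\sum_(j < m) (4 * `|weight G j - b j| +
     2 * (b j * (`|mean G j - t j| + `|sdev G j - s j|))))%:E)%E.
Proof.
move=> b0 G'E.
pose I1 j := \1_`[Num.min (mean G j) (t j), Num.max (mean G j) (t j)] : R -> R.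
pose I2 j := \1_`[Num.min (sdev G j) (s j), Num.max (sdev G j) (s j)] : R -> R.
pose F j (v : R * R) : \bar R := ((`|weight G j - b j|)%:E * (k v.1 * k v.2)%:E +
  ((b j)%:E * (I1 j v.1 * k v.2)%:E + (b j)%:E * (k v.1 * I2 j v.2)%:E))%E.
have k0 x : 0 <= k x by exact: expR_ge0.
have k1 x : k x <= 1 by rewrite /k -expR0 ler_expR oppr_le0.
have I10 j x : 0 <= I1 j x by rewrite /I1 indicE.
have I20 j x : 0 <= I2 j x by rewrite /I2 indicE.
have mprod (u w : R -> R) : measurable_fun setT u -> measurable_fun setT w ->
    measurable_fun setT (fun v : R * R => (u v.1 * w v.2)%:E).
  move=> mu' mw; apply/measurable_EFinP; apply: measurable_funM.
    by apply: measurableT_comp => //; exact: measurable_fst.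
  by apply: measurableT_comp => //; exact: measurable_snd.
have mI1 j : measurable_fun setT (I1 j) by exact: measurable_indic.
have mI2 j : measurable_fun setT (I2 j) by exact: measurable_indic.
have mkk := mprod _ _ mk mk.
have mIk j := mprod _ _ (mI1 j) mk.
have mkI j := mprod _ _ mk (mI2 j).
have mF j : measurable_fun setT (F j).
  by apply: emeasurable_funD; last apply: emeasurable_funD; exact: emeasurable_funM.
have F0 j v : (0 <= F j v)%E.
  by rewrite /F -!EFinM -!EFinD lee_fin !addr_ge0 ?mulr_ge0.
have cdfE (H : mixing R m) v : mixing_cdf H v =
    \sum_(j < m) weight H j * ((mean H j <= v.1) && (sdev H j <= v.2))%:R.
  rewrite /mixing_cdf big_mkcond/=; apply: eq_bigr => j _.
  by case: (_ && _); rewrite ?mulr1 ?mulr0.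
have bE v : \sum_(j < m | (t j <= v.1) && (s j <= v.2)) b j =
    \sum_(j < m) b j * ((t j <= v.1) && (s j <= v.2))%:R.
  rewrite big_mkcond/=; apply: eq_bigr => j _.
  by case: (_ && _); rewrite ?mulr1 ?mulr0.
have stepE (x y : R) (v : R * R) : ((x <= v.1) && (y <= v.2))%:R =
    \1_`[x, +oo[ v.1 * \1_`[y, +oo[ v.2 :> R.
  by rewrite !indicE !mem_setE !in_itv/= !andbT -natrM mulnb.
have mcdf (H : mixing R m) : measurable_fun setT (mixing_cdf H).
  rewrite (_ : mixing_cdf H = fun v => \sum_(j < m) weight H j *
      (\1_`[mean H j, +oo[ v.1 * \1_`[sdev H j, +oo[ v.2)); last first.
    by apply/funext => v; rewrite cdfE; under eq_bigr do rewrite stepE.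
  apply: measurable_sum => j; apply: measurable_funM => //.
  apply: measurable_funM.
    by apply: measurableT_comp; [exact: measurable_indic|exact: measurable_fst].
  by apply: measurableT_comp; [exact: measurable_indic|exact: measurable_snd].
pose D (v : R * R) : \bar R := (`|mixing_cdf G v - mixing_cdf G' v| *
  expR (- (`|v.1| + `|v.2|)))%:E.
have mD : measurable_fun setT D.
  apply/measurable_EFinP; apply: measurable_funM.
    by apply: measurableT_comp => //; exact: measurable_funB.
  rewrite (_ : (fun _ => _) = (fun v : R * R => k v.1 * k v.2)); last first.
    by apply/funext => v; rewrite /k -expRD opprD.
  exact/measurable_EFinP.
have D0 v : (0 <= D v)%E by rewrite lee_fin mulr_ge0// expR_ge0.
have DF v : (D v <= \sum_(j < m) F j v)%E.
  rewrite /D (_ : (\sum_(j < m) F j v)%E = (\sum_(j < m) (`|weight G j - b j| * (k v.1 * k v.2) +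
      (b j * (I1 j v.1 * k v.2) + b j * (k v.1 * I2 j v.2))))%:E); last first.
    by rewrite -sumEFin; apply: eq_bigr => j _; rewrite /F -!EFinM -!EFinD.
  rewrite lee_fin G'E cdfE bE -sumrB opprD expRD -/(k _) -/(k _).
  have kk0 : 0 <= k v.1 * k v.2 by rewrite mulr_ge0.
  apply: (@le_trans _ _ ((\sum_(j < m) (`|weight G j - b j| +
      b j * (I1 j v.1 + I2 j v.2))) * (k v.1 * k v.2))).
    rewrite ler_wpM2r// (le_trans (ler_norm_sum _ _ _))//; apply: ler_sum => j _.
    set st := _%:R; set st' := _%:R.
    (* Parameter gaps are weighted by the limit weight [b j], so components whose limit weight is 0
       may have wandering parameters. *)
    have -> : weight G j * st - b j * st' = (weight G j - b j) * st + b j * (st - st').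
      by ring.
    rewrite (le_trans (ler_normD _ _))// !normrM lerD//.
      by rewrite ler_piMr// ger0_norm /st// lern1 leq_b1.
    by rewrite ger0_norm// ler_wpM2l// step_pair_dist.
  rewrite mulr_suml; apply: ler_sum => j _.
  rewrite mulrDl lerD2l -mulrA -mulrDr ler_wpM2l// mulrDl.
  apply: lerD.
    by rewrite ler_wpM2l// ler_piMl.
  by rewrite [leRHS]mulrC ler_wpM2l// ler_piMr.
pose A : R := fine (\int[mu]_x (k x)%:E)%E.
have iA : (\int[mu]_x (k x)%:E = A%:E)%E.
  rewrite fineK// ge0_fin_numE; last by apply: integral_ge0 => x _; rewrite lee_fin.
  exact: le_lt_trans integral_exp_abs_le2 (ltry _).
have A2 : 0 <= A <= 2.
  rewrite -!lee_fin -iA integral_exp_abs_le2 andbT.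
  by apply: integral_ge0 => x _; rewrite lee_fin.
have iF j : (\int[(mu \x mu)%E]_v F j v <= (4 * `|weight G j - b j| +
     2 * (b j * (`|mean G j - t j| + `|sdev G j - s j|)))%:E)%E.
  have bI0 v : (0 <= (b j)%:E * (I1 j v.1 * k v.2)%:E)%E.
    by rewrite -EFinM lee_fin !mulr_ge0.
  have bI0' v : (0 <= (b j)%:E * (k v.1 * I2 j v.2)%:E)%E.
    by rewrite -EFinM lee_fin !mulr_ge0.
  rewrite /F ge0_integralD//; last 4 first.
  - by move=> v _; rewrite -EFinM lee_fin !mulr_ge0.
  - exact: emeasurable_funM.
  - by move=> v _; rewrite adde_ge0.
  - apply: emeasurable_funD; apply: emeasurable_funM => //.
      exact: mIk.
    exact: mkI.
  rewrite ge0_integralD//; last 2 first.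
  - by apply: emeasurable_funM => //; exact: mIk.
  - by apply: emeasurable_funM => //; exact: mkI.
  have Zl (c : R) (u w : R -> R) : 0 <= c -> measurable_fun setT u ->
      measurable_fun setT w -> (forall x, 0 <= u x) -> (forall x, 0 <= w x) ->
      (\int[(mu \x mu)%E]_v (c%:E * (u v.1 * w v.2)%:E) =
       c%:E * (\int[mu]_x (u x)%:E * \int[mu]_y (w y)%:E))%E.
    move=> c0 mu' mw u0 w0; rewrite ge0_integralZl_EFin ?ge0_integral_prod_mul//.
      by move=> v _; rewrite lee_fin mulr_ge0.
    exact: mprod.
  rewrite (Zl _ k k)// (Zl _ (I1 j) k)// (Zl _ k (I2 j))// iA !integral_strip -!EFinM -!EFinD lee_fin.
  case/andP: A2 => A0 A2.
  have AA : A * A <= 4 by nra.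
  have := @ler_wpM2l _ `|weight G j - b j| (normr_ge0 _) _ _ AA.
  have := @ler_wpM2l _ (b j * `|mean G j - t j|) (mulr_ge0 (b0 j) (normr_ge0 _)) _ _ A2.
  have := @ler_wpM2l _ (b j * `|sdev G j - s j|) (mulr_ge0 (b0 j) (normr_ge0 _)) _ _ A2.
  lra.
apply: (@le_trans _ _ (\int[(mu \x mu)%E]_v D v)%E).
  apply: ge0_subset_integral => //.
  rewrite (_ : [set v : R * R | 0 < v.2] = snd @^-1` `]0, +oo[%classic); last first.
    by apply/seteqP; split => v /=; rewrite in_itv/= andbT.
  by rewrite -[X in measurable X]setTI; apply: measurable_snd.
apply: (@le_trans _ _ (\int[(mu \x mu)%E]_v (\sum_(j < m) F j v))%E).
  by apply: ge0_le_integral => //; exact: emeasurable_sum.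
rewrite ge0_integral_sum// -sumEFin.
by apply: lee_sum => j _; exact: iF.
Qed.
End D_KW_bound.

(** * Components along an ultrafilter *)

Section ultrafilter.
Context {R : realType} (U : set_system nat) {U_ultra : UltraFilter U}.

(** A sequence bounded along [U] has a cluster point by compactness, and an ultrafilter converges to
    its cluster points. All parameters of all components are thus treated at once, without nested
    subsequences. *)
Lemma ultra_cvg_or_diverges (u : nat -> R) :
  (exists l, forall e : R, 0 < e -> \forall n \near U, `|u n - l| <= e) \/
  (forall K, \forall n \near U, K < `|u n|).
Proof.
have [[K bK]|nb] := pselect (exists K, \forall n \near U, `|u n| <= K); last first.
  right=> K; have [//|h] := in_ultra_setVsetC [set n | K < `|u n|] U_ultra.
  exfalso; apply: nb; exists K; apply: filterS h => n /= /negP.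
  by rewrite -leNgt.
left; have UP : ProperFilter (u @ U) by exact: fmap_proper_filter.
have : (u @ U) `[- K, K]%classic.
  by apply: filterS bK => n /=; rewrite in_itv/= ler_norml.
move=> /(@segment_compact R (- K) K _ UP) [l [_ lc]].
exists l => e e0.
have [//|h] := in_ultra_setVsetC [set n | `|u n - l| <= e] U_ultra.
exfalso; have [] := lc (u @` ~` [set n | `|u n - l| <= e]) (ball l e).
- by rewrite /fmap /=; apply: filterS h => n nh /=; exists n.
- exact: nbhsx_ballx.
move=> y [[n /= /negP nh <-]]; rewrite /ball/= => lt.
by move/negP: nh; apply; rewrite distrC ltW.
Qed.

End ultrafilter.

(** * Growth of ln n *)

Section log_asymptotics.
Context {R : realType}.

Lemma near_le_natr (K : R) : \forall n \near \oo, K <= n%:R.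
Proof. exact: nbhs_infty_ger. Qed.

Lemma near_le_ln (K : R) : \forall n \near \oo, K <= ln n%:R.
Proof.
near=> n; have n0 : 0 < n%:R :> R.
  by apply: lt_le_trans (expR_gt0 K) _; near: n; exact: near_le_natr.
rewrite -ler_expR lnK ?posrE//; near: n; exact: near_le_natr.
Unshelve. all: by end_near. Qed.

Lemma near_sqr_ln_le (e : R) : 0 < e -> \forall n \near \oo, ln n%:R ^+ 2 <= e * n%:R.
Proof.
move=> e0; near=> n; have n1 : 1 <= n%:R :> R by near: n; exact: near_le_natr.
have n0 : 0 < n%:R :> R by exact: lt_le_trans n1.
have l0 : 0 <= ln n%:R :> R by rewrite ln_ge0.
have h1 : ln n%:R <= 4 * root4 n%:R :> R.
  by rewrite (le_trans (ln_le_root4 n0))// ler_wpM2l// gerBl.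
have h2 : ln n%:R ^+ 2 <= 16 * Num.sqrt n%:R :> R.
  rewrite -sqr_root4 (_ : 16 * _ = (4 * root4 n%:R) ^+ 2); last by ring.
  by rewrite lerXn2r// nnegrE// mulr_ge0// root4_ge0.
rewrite (le_trans h2)// -[n%:R in leRHS]sqr_sqrtr ?(ltW n0)//.
rewrite expr2 mulrA ler_wpM2r ?sqrtr_ge0// mulrC -ler_pdivrMr//.
have : (16 / e) ^+ 2 <= n%:R by near: n; exact: near_le_natr.
move/ler_wsqrtr; rewrite sqrtr_sqr ger0_norm// divr_ge0// ltW.
Unshelve. all: by end_near. Qed.
End log_asymptotics.

(** * Components that converge, flatten out or degenerate *)

Section components.
Context {R : realType} (x : nat -> R) (q : nat -> R -> R).
Hypothesis window_count : exists2 C : R, 0 < C &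
  \forall n \near \oo, forall t r : R, 0 <= r ->
    #|[pred i : 'I_n | `|x i - t| <= r]|%:R <= C * (n%:R * r + ln n%:R) :> R.
Hypothesis q_le : forall e : R, 0 < e -> \forall n \near \oo, forall s : R, 0 < s ->
  q n s <= e * n%:R.
Hypothesis q_small : penalty_P3 q.
Hypothesis tails : forall e : R, 0 < e -> exists T : R, \forall n \near \oo,
  #|[pred i : 'I_n | T < `|x i|]|%:R <= e * n%:R :> R.

Lemma sum_ln_indicator n (p : pred nat) (c e : R) :
  \sum_(i < n) ln (1 + (p i)%:R * c / e) =
  #|[pred i : 'I_n | p i]|%:R * ln (1 + c / e).
Proof.
rewrite mulr_natl -sumr_const [RHS]big_mkcond/=; apply: eq_bigr => i _.
by rewrite inE; case: (p i); rewrite ?mul1r// !mul0r addr0 ln1.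
Qed.

(* If the window around t is wide enough for the density to be at most e
   outside it, the log-likelihood gained inside is paid for by the window count,
   and by the penalty once s < ln n / n. *)
Definition absorbed (n : nat) (a t s e d : R) (f : R -> R) := exists2 E : nat -> R,
  (forall i, 0 <= E i /\ a * normal_pdf t s (x i) <= f (x i) + e + E i) &
  \sum_(i < n) ln (1 + E i / e) + q n s <= d * n%:R.

Lemma absorbed_by_window n (a t s e d w : R) : 0 <= a <= 1 -> 0 < s -> 0 < e -> 0 <= w ->
  s^-1 * expR (- (w ^+ 2 / (s ^+ 2 * 2))) <= e ->
  #|[pred i : 'I_n | `|x i - t| <= w]|%:R * ln (1 + s^-1 / e) + q n s <= d * n%:R ->
  absorbed n a t s e d (cst 0).
Proof.
move=> /andP[a0 a1] s0 e0 w0 far cnt.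
exists (fun i => (`|x i - t| <= w)%R%:R * s^-1); last first.
  by rewrite (sum_ln_indicator n (fun i => `|x i - t| <= w)).
move=> i; split; first by rewrite mulr_ge0// invr_ge0 ltW.
rewrite /cst add0r; apply: (@le_trans _ _ (normal_pdf t s (x i))).
  by rewrite ler_piMl// normal_pdf_ge0.
have [h|h] := leP `|x i - t| w.
  by rewrite mul1r (le_trans (normal_pdf_le_inv _ _ s0))// lerDr ltW.
by rewrite mul0r addr0 (le_trans (normal_pdf_far s0 w0 (ltW h))).
Qed.

(** Two regimes meet at s = ln n / n. Above it, the window sqrt s holds O(n sqrt s + ln n)
    observations, each gaining at most 2 |ln s|; this is a small multiple of n because sqrt s |ln s|
    is small and |ln s| <= ln n. Below it, a window of order (ln n)^(3/2) / n holds at most (ln n)^2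
    / 2 observations, whose gain (ln n)^2 |ln s| is cancelled by the penalty. *)
Lemma shrinking_component_absorbed (e d : R) : 0 < e -> 0 < d ->
  exists2 tau : R, 0 < tau & \forall n \near \oo, forall a t s, 0 <= a <= 1 ->
    0 < s -> s < tau -> absorbed n a t s e d (cst 0).
Proof.
move=> e0 d0; have [C C0 HC] := window_count.
(* The bounds e/8 and 1/2 give 1 + 1/(s e) <= s^(-2); e/8 also makes the density at most 8 s <= e
   outside the window sqrt s. The fourth power gives sqrt s |ln s| <= 4 root4 s <= d / (6 C). *)
pose tau := Num.min (Num.min (e / 8) 2^-1) ((d / (24 * C)) ^+ 4).
have dC0 : 0 < d / (24 * C) by rewrite divr_gt0// mulr_gt0.
exists tau.
  by rewrite !lt_min !divr_gt0//= invr_gt0 ltr0n exprn_gt0.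
near=> n => a t s a01 s0 st.
have [st1 st2 st3] : [/\ s < e / 8, s < 2^-1 & s < (d / (24 * C)) ^+ 4].
  by move: st; rewrite /tau !lt_min => /andP[/andP[-> ->] ->].
set L := - ln s.
have L0 : 0 <= L by rewrite oppr_ge0 ln_le0//; lra.
have ln_le : ln (1 + s^-1 / e) <= 2 * L.
  have -> : 2 * L = ln ((s^-1) ^+ 2).
    by rewrite lnXn ?invr_gt0// lnV ?posrE// mulr_natl.
  rewrite ler_ln ?posrE; last 2 first.
    by rewrite addr_gt0// divr_gt0// invr_gt0.
    by rewrite exprn_gt0// invr_gt0.
  rewrite -(ler_pM2r (exprn_gt0 2 s0)).
  rewrite (_ : (1 + s^-1 / e) * s ^+ 2 = s ^+ 2 + s / e); last first.
    by field; rewrite !gt_eqF.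
  rewrite -exprMn mulVf ?gt_eqF// expr1n.
  have : s / e <= 8^-1 by rewrite ler_pdivrMr// mulrC ltW.
  have : s ^+ 2 <= 2^-1 * 2^-1 by rewrite expr2 ler_pM// ltW.
  lra.
have n1 : 1 <= n%:R :> R by near: n; exact: near_le_natr.
have n0 : 0 < n%:R :> R by exact: lt_le_trans n1.
have l1 : 1 <= ln n%:R :> R by near: n; exact: near_le_ln.
have l0 : 0 < ln n%:R :> R by exact: lt_le_trans l1.
have Hn : forall t r, 0 <= r ->
    #|[pred i : 'I_n | `|x i - t| <= r]|%:R <= C * (n%:R * r + ln n%:R) :> R.
  by near: n.
have h0 : 0 < n%:R^-1 * ln n%:R :> R by rewrite mulr_gt0// invr_gt0.
have [sh|sh] := leP (n%:R^-1 * ln n%:R) s.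
  have w0 := sqrtr_ge0 s.
  apply: (@absorbed_by_window n a t s e d (Num.sqrt s)) => //.
    rewrite sqr_sqrtr ?(ltW s0)//; set z := s / _.
    have z0 : 0 < z by rewrite divr_gt0 ?mulr_gt0 ?exprn_gt0.
    have zE : z^-1 = 2 * s by rewrite /z; field; rewrite gt_eqF.
    (* Second order is needed: 1/z = 2 s would only compensate the factor 1/s, without making the
       product small. *)
    have ez : expR (- z) <= 2 / z ^+ 2.
      have h := expR_ge1Dxn 1 (ltW z0); rewrite expRN -[leRHS]invf_div.
      rewrite lef_pV2 ?posrE ?expR_gt0 ?divr_gt0 ?exprn_gt0//.
      by apply: le_trans h; rewrite lerDr.
    apply: (@le_trans _ _ (s^-1 * (2 / z ^+ 2))).
      by rewrite ler_wpM2l// invr_ge0 ltW.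
    rewrite -exprVn zE (_ : s^-1 * _ = 8 * s); last by field; rewrite gt_eqF.
    by rewrite mulrC -ler_pdivlMr// ltW.
  have Lln : L <= ln n%:R.
    rewrite -[leRHS]opprK /L lerN2 -lnV ?posrE// ler_ln ?posrE ?invr_gt0//.
    by apply: le_trans sh; rewrite ler_pMr// invr_gt0.
  have sL : Num.sqrt s * L <= d / (6 * C).
    have -> : L = ln s^-1 by rewrite lnV ?posrE.
    apply: (@le_trans _ _ (Num.sqrt s * (4 * root4 s^-1))).
      by rewrite ler_wpM2l// (le_trans (ln_le_root4 _)) ?invr_gt0// ler_wpM2l// gerBl.
    have rs : root4 s * root4 s^-1 = 1.
      by rewrite -root4M ?(ltW s0)// mulfV ?gt_eqF// /root4 !sqrtr1.
    rewrite -sqr_root4 [leLHS](_ : _ = 4 * root4 s * (root4 s * root4 s^-1)); last by ring.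
    rewrite rs mulr1.
    have : root4 s <= d / (24 * C).
      have := ler_root4 (ltW st3); rewrite {2}/root4 (exprM _ 2 2) sqrtr_sqr.
      by rewrite ger0_norm ?sqr_ge0// sqrtr_sqr ger0_norm// ltW.
    rewrite (_ : d / (6 * C) = 4 * (d / (24 * C))); last by field; rewrite gt_eqF.
    by rewrite ler_pM2l.
  have cnt := Hn t _ w0.
  have q1 : q n s <= d / 3 * n%:R.
    have : forall s, 0 < s -> q n s <= d / 3 * n%:R.
      by near: n; apply: q_le; rewrite divr_gt0.
    exact.
  have ll : ln n%:R ^+ 2 <= d / (6 * C) * n%:R.
    by near: n; apply: near_sqr_ln_le; rewrite divr_gt0// mulr_gt0.
  have step : #|[pred i : 'I_n | `|x i - t| <= Num.sqrt s]|%:R * ln (1 + s^-1 / e) <=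
      C * (n%:R * Num.sqrt s + ln n%:R) * (2 * L).
    rewrite ler_pM// ln_ge0// lerDl divr_ge0 ?(ltW e0)// invr_ge0 ltW//.
  have step2 : C * (n%:R * Num.sqrt s + ln n%:R) * (2 * L) <= 2 / 3 * (d * n%:R).
    have e1 : n%:R * (Num.sqrt s * L) <= n%:R * (d / (6 * C)) by rewrite ler_wpM2l.
    have e2 : ln n%:R * L <= ln n%:R ^+ 2 by rewrite expr2 ler_wpM2l// ltW.
    have e3 : n%:R * (Num.sqrt s * L) + ln n%:R * L <= 2 * (d / (6 * C) * n%:R) by lra.
    have := @ler_wpM2l _ (2 * C) _ _ _ e3; rewrite mulr_ge0 ?(ltW C0)// => /(_ isT).
    rewrite (_ : 2 * C * (2 * (d / (6 * C) * n%:R)) = 2 / 3 * (d * n%:R)); last first.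
      by field; rewrite gt_eqF.
    lra.
  lra.
have qs : q n s < ln n%:R ^+ 2 * ln s.
  have : forall s, 0 < s -> s < n%:R^-1 * ln n%:R -> q n s < ln n%:R ^+ 2 * ln s.
    by near: n; exact: q_small.
  exact.
(* The exponent becomes 2 r^2 ln n with r = (ln n / n) / s >= 1. One half yields 1/n; the other is
   traded for 1 / (r^2 ln n), as [s] has no lower bound. Still n w = 2 (ln n)^(3/2) is o((ln
   n)^2). *)
pose w : R := 2 * (n%:R^-1 * ln n%:R) * Num.sqrt (ln n%:R).
have w0 : 0 <= w by rewrite !mulr_ge0 ?sqrtr_ge0 ?invr_ge0 ?(ltW l0).
apply: (@absorbed_by_window n a t s e d w) => //.
  pose h : R := n%:R^-1 * ln n%:R.
  pose r := h / s; have r1 : 1 <= r by rewrite ler_pdivlMr// mul1r ltW.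
  have -> : w ^+ 2 / (s ^+ 2 * 2) = 2 * r ^+ 2 * ln n%:R.
    rewrite /w !exprMn sqr_sqrtr ?(ltW l0)// -/h -exprMn /r.
    by field; rewrite !gt_eqF.
  have r2 : 1 <= r ^+ 2 by rewrite exprn_ege1.
  have b1 : expR (- (2 * r ^+ 2 * ln n%:R)) <= n%:R^-1 * (r ^+ 2 * ln n%:R)^-1.
    have rl0 : 0 < r ^+ 2 * ln n%:R by rewrite mulr_gt0// (lt_le_trans ltr01).
    apply: (@le_trans _ _ (expR (- ln n%:R) * expR (- (r ^+ 2 * ln n%:R)))).
      rewrite -expRD ler_expR.
      have := @ler_wpM2r _ (ln n%:R) (ltW l0) _ _ r2; lra.
    rewrite -lnV ?posrE// lnK ?posrE ?invr_gt0// ler_wpM2l ?invr_ge0//.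
    by rewrite -[leRHS]mul1r ler_pdivlMr// mulrC mul_expRN_le1.
  apply: (@le_trans _ _ (s^-1 * (n%:R^-1 * (r ^+ 2 * ln n%:R)^-1))).
    by rewrite ler_wpM2l// invr_ge0 ltW.
  have -> : s^-1 * (n%:R^-1 * (r ^+ 2 * ln n%:R)^-1) = (ln n%:R ^+ 2)^-1 * r^-1.
    by rewrite /r /h; field; rewrite !gt_eqF.
  apply: (@le_trans _ _ ((ln n%:R)^-1 * 1)).
    rewrite ler_pM ?invr_ge0 ?exprn_ge0 ?(ltW l0) ?(le_trans ler01 r1)//.
      by rewrite lef_pV2 ?posrE ?exprn_gt0// expr2 ler_peMr// ltW.
    by rewrite invf_le1// (lt_le_trans ltr01).
  rewrite mulr1 -[leRHS]invrK lef_pV2 ?posrE ?invr_gt0//.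
  by near: n; exact: near_le_ln.
have cnt := Hn t _ w0; set S := Num.sqrt (ln n%:R) in w w0 cnt *.
have S2 : ln n%:R = S ^+ 2 by rewrite sqr_sqrtr// ltW.
have S1 : 1 <= S by rewrite -sqrtr1 ler_wsqrtr.
have SC : 6 * C <= S.
  have : (6 * C) ^+ 2 <= ln n%:R by near: n; exact: near_le_ln.
  by move/ler_wsqrtr; rewrite sqrtr_sqr ger0_norm// mulr_ge0// ltW.
have cnt2 : #|[pred i : 'I_n | `|x i - t| <= w]|%:R <= ln n%:R ^+ 2 / 2 :> R.
  apply: (le_trans cnt).
  rewrite (_ : n%:R * w = 2 * ln n%:R * S); last by rewrite /w; field; rewrite gt_eqF.
  rewrite S2; apply: (@le_trans _ _ (C * (3 * S ^+ 3))).
    rewrite ler_wpM2l ?(ltW C0)//.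
    have : S ^+ 2 * 1 <= S ^+ 2 * S by rewrite ler_wpM2l// sqr_ge0.
    rewrite [S ^+ 3]exprSr; lra.
  rewrite -exprM (exprSr S 3) ler_pdivlMr//.
  have : S ^+ 3 * (6 * C) <= S ^+ 3 * S.
    by rewrite ler_wpM2l// exprn_ge0// (le_trans ler01).
  lra.
have step : #|[pred i : 'I_n | `|x i - t| <= w]|%:R * ln (1 + s^-1 / e) <=
    ln n%:R ^+ 2 / 2 * (2 * L).
  by rewrite ler_pM// ln_ge0// lerDl divr_ge0 ?(ltW e0)// invr_ge0 ltW.
have dn : 0 <= d * n%:R by rewrite mulr_ge0// ltW.
by move: step qs dn; rewrite /L; lra.
Unshelve. all: by end_near. Qed.

Section along_ultrafilter.
Variables (U : set_system nat) (U_ultra : UltraFilter U) (U_oo : \oo `<=` U).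

Let near_U (Q : nat -> Prop) : (\forall n \near \oo, Q n) -> \forall n \near U, Q n.
Proof. by move=> h; exact: U_oo. Qed.

(* [b] is the weight kept by the limit component: the limit [a0] of the weights
   in the convergent case, 0 otherwise. *)
Lemma component_limit (a t s : nat -> R) : (forall n, 0 <= a n <= 1) ->
  (forall n, 0 < s n) ->
  exists b t0 s0 a0 : R, [/\ 0 <= b <= a0, 0 < s0,
    (forall e, 0 < e -> \forall n \near U, `|a n - a0| <= e),
    (forall e, 0 < e -> \forall n \near U,
       b * (`|t n - t0| + `|s n - s0|) <= e) &
    (forall e d, 0 < e -> 0 < d -> \forall n \near U,
       absorbed n (a n) (t n) (s n) e d (fun y => b * normal_pdf t0 s0 y))].
Proof.
move=> a01 s0.
have [[a0 a_cvg]|aoo] := ultra_cvg_or_diverges (U := U) a; last first.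
  have [n] := filter_ex (aoo 1); case/andP: (a01 n) => h1 h2.
  by rewrite ger0_norm// ltNge h2.
have a0_ge0 : 0 <= a0.
  rewrite leNgt; apply/negP => a0n; have e0 : 0 < - a0 / 2 by lra.
  have [n] := filter_ex (a_cvg _ e0); case/andP: (a01 n) => h1 h2.
  by rewrite ler_distl => /andP[]; lra.
have norm_s n : `|s n| = s n by rewrite ger0_norm// ltW.
have irregular : (forall e d, 0 < e -> 0 < d -> \forall n \near U,
       absorbed n (a n) (t n) (s n) e d (cst 0)) ->
    exists b t0 s0 a0 : R, [/\ 0 <= b <= a0, 0 < s0,
    (forall e, 0 < e -> \forall n \near U, `|a n - a0| <= e),
    (forall e, 0 < e -> \forall n \near U,
       b * (`|t n - t0| + `|s n - s0|) <= e) &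
    (forall e d, 0 < e -> 0 < d -> \forall n \near U,
       absorbed n (a n) (t n) (s n) e d (fun y => b * normal_pdf t0 s0 y))].
  (* The limit component has weight 0, so its mean 0 and deviation 1 are placeholders; the weight
     [a0] is counted as lost mass. *)
  move=> H; exists 0, 0, 1, a0; split => //; first by rewrite lexx.
    by move=> e e0; apply: nearW => n; rewrite mul0r ltW.
  move=> e d e0 d0; rewrite (_ : (fun _ => _) = cst 0); first exact: H.
  by apply/funext => y; rewrite mul0r.
have apdf n e y : normal_pdf (t n) (s n) y <= e -> a n * normal_pdf (t n) (s n) y <= e.
  by case/andP: (a01 n) => h1 h2; apply: le_trans; rewrite ler_piMl// normal_pdf_ge0.
have plain n e d (f : R -> R) :
    (forall y, a n * normal_pdf (t n) (s n) y <= f y + e) ->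
    q n (s n) <= d * n%:R -> absorbed n (a n) (t n) (s n) e d f.
  move=> h1 h2; exists (cst 0); first by move=> i; rewrite addr0.
  by rewrite big1 ?add0r// => i _; rewrite mul0r addr0 ln1.
have qU d : 0 < d -> \forall n \near U, q n (s n) <= d * n%:R.
  by move=> d0; apply: near_U; apply: filterS (q_le d0) => n; exact.
have [[l s_cvg]|soo] := ultra_cvg_or_diverges (U := U) s; last first.
  apply: irregular => e d e0 d0; near=> n; apply: plain; last by near: n; exact: qU.
  move=> y; rewrite /cst add0r; apply: apdf.
  rewrite (le_trans (normal_pdf_le_inv _ _ (s0 n)))//.
  rewrite -[leRHS]invrK lef_pV2 ?posrE ?invr_gt0// -norm_s ltW//.
  by near: n; exact: soo.
have l_ge0 : 0 <= l.
  rewrite leNgt; apply/negP => ln; have e0 : 0 < - l / 2 by lra.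
  have [n] := filter_ex (s_cvg _ e0); have := s0 n.
  by rewrite ler_distl => h /andP[]; lra.
have [l0|l0] := leP l 0.
  apply: irregular => e d e0 d0.
  have [tau tau0 Htau] := shrinking_component_absorbed e0 d0.
  near=> n; have Hn : forall a t s, 0 <= a <= 1 -> 0 < s -> s < tau ->
     absorbed n a t s e d (cst 0) by near: n; exact: near_U.
  apply: Hn => //; have : `|s n - l| <= tau / 2.
    by near: n; apply: s_cvg; rewrite divr_gt0.
  by rewrite ler_distl => /andP[]; lra.
have s_near : \forall n \near U, l / 2 <= s n <= 2 * l.
  have l2 : 0 < l / 2 by rewrite divr_gt0.
  by apply: filterS (s_cvg _ l2) => n; rewrite ler_distl; lra.
have [[t0 t_cvg]|too] := ultra_cvg_or_diverges (U := U) t.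
  exists a0, t0, l, a0; split => //; first by rewrite a0_ge0 lexx.
    move=> e e0; pose c := e / (2 * (a0 + 1)).
    have a1 : 0 < 2 * (a0 + 1) by rewrite mulr_gt0// ltr_wpDl.
    have c0 : 0 < c by rewrite divr_gt0.
    near=> n; apply: (@le_trans _ _ (a0 * (c + c))).
      rewrite ler_wpM2l// lerD//; [near: n; exact: t_cvg|near: n; exact: s_cvg].
    rewrite (_ : a0 * (c + c) = e * (a0 / (a0 + 1))); last first.
      by rewrite /c; field; rewrite !gt_eqF// ltr_wpDl.
    by rewrite ler_piMr ?(ltW e0)// ler_pdivrMr ?ltr_wpDl// mul1r lerDl.
  move=> e d e0 d0.
  have [eta eta0 Heta] := weighted_normal_pdf_param_continuous a0 t0 l0 e0.
  near=> n; apply: plain; last by near: n; exact: qU.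
  move=> y; have [||| _ /(_ y)] := Heta (a n) (t n) (s n).
  - by near: n; exact: a_cvg.
  - by near: n; exact: t_cvg.
  - by near: n; exact: s_cvg.
  by rewrite ler_distl => /andP[]; lra.
apply: irregular => e d e0 d0.
(* The mean escapes while the deviation stays between l/2 and 2 l. Only observations beyond [T] can
   lie near the mean; each gains at most [c], and their frequency is at most d / (2 (c + 1)). *)
pose c := ln (1 + (2 / l) / e).
have c0 : 0 <= c by rewrite /c ln_ge0// lerDl !divr_ge0// ltW.
have d2 : 0 < d / (2 * (c + 1)) by rewrite divr_gt0// mulr_gt0// ltr_wpDl.
have [T HT] := tails d2.
pose W := 1 + 4 * l / e.
have W1 : 1 <= W by rewrite lerDl divr_ge0 ?(ltW e0)// mulr_ge0.
near=> n.
have /andP[sn1 sn2] : l / 2 <= s n <= 2 * l by near: n.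
have tn : `|T| + W < `|t n| by near: n; exact: too.
exists (fun i => (T < `|x i|)%R%:R * (2 / l)).
  move=> i; split; first by rewrite mulr_ge0// divr_ge0.
  rewrite /cst add0r; have [h|h] := ltP T `|x i|.
    rewrite mul1r; apply: (@le_trans _ _ (2 / l)); last by rewrite lerDr ltW.
    apply: apdf; rewrite (le_trans (normal_pdf_le_inv _ _ (s0 n)))//.
    by rewrite -[leRHS]invf_div lef_pV2// posrE ?divr_gt0.
  rewrite mul0r addr0; apply: apdf.
  have wx : W <= `|x i - t n|.
    have := ler_normD (t n - x i) (x i); rewrite subrK distrC.
    have := ler_norm T; lra.
  apply: (le_trans (normal_pdf_far_le (s0 n) W1 wx)).
  have W0 : 0 < W by exact: lt_le_trans W1.
  rewrite ler_pdivrMr// /W mulrDr mulr1 mulrCA divff ?gt_eqF// mulr1.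
  lra.
rewrite (sum_ln_indicator n (fun i => T < `|x i|)%R) -/c.
have q2 : q n (s n) <= d / 2 * n%:R.
  by near: n; apply: qU; rewrite divr_gt0.
have cnt : #|[pred i : 'I_n | T < `|x i|]|%:R <= d / (2 * (c + 1)) * n%:R.
  by near: n; exact: near_U.
have := @ler_wpM2r _ c c0 _ _ cnt.
have n0 : 0 <= n%:R :> R by [].
have : d / (2 * (c + 1)) * n%:R * c <= d / 2 * n%:R.
  rewrite (_ : _ * c = d / 2 * n%:R * (c / (c + 1))); last first.
    by field; rewrite gt_eqF// ltr_wpDl.
  rewrite ler_piMr ?mulr_ge0 ?divr_ge0 ?(ltW d0)//.
  by rewrite ler_pdivrMr ?ltr_wpDl// mul1r lerDl.
lra.
Unshelve. all: by end_near. Qed.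
End along_ultrafilter.
End components.

(** * Consistency *)

Section log_likelihood.
Context {R : realType}.

(** The terms are peeled off one by one: a + S + E <= (a + S) (1 + E/e), because e <= a + S. *)
Lemma ln_add_sum_le (I : Type) (r : seq I) (E : I -> R) (a e : R) : 0 < e -> e <= a ->
  (forall i, 0 <= E i) ->
  ln (a + \sum_(i <- r) E i) <= ln a + \sum_(i <- r) ln (1 + E i / e).
Proof.
move=> e0 ea E0; elim: r => [|i r IH]; first by rewrite !big_nil !addr0.
rewrite !big_cons addrCA addrA [E i + a]addrC -addrA; set S := \sum_(j <- r) E j in IH *.
have S0 : 0 <= S by exact: sumr_ge0.
have a0 : 0 < a by exact: lt_le_trans ea.
have Ei : 0 <= E i / e by rewrite divr_ge0// ltW.
apply: (@le_trans _ _ (ln ((a + S) * (1 + E i / e)))).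
  rewrite ler_ln ?posrE; last 2 first.
  - by rewrite ltr_pwDl// addr_ge0.
  - by rewrite mulr_gt0// ltr_pwDl.
  have : e * (E i / e) <= (a + S) * (E i / e).
    by rewrite ler_wpM2r// (le_trans ea)// lerDl.
  rewrite mulrCA divff ?gt_eqF// mulr1; lra.
rewrite lnM ?posrE ?ltr_pwDl//; lra.
Qed.

Lemma mixture_pdf_gt0 m (G : mixing R m) y : 0 < mixture_pdf G y.
Proof.
have p0 j : 0 <= weight G j * normal_pdf (mean G j) (sdev G j) y.
  by rewrite mulr_ge0 ?weight_ge0// normal_pdf_ge0.
rewrite lt_def sumr_ge0// andbT; apply/negP => /eqP /psumr_eq0P h.
have := weight_sum1 G; rewrite big1; first by move/esym/eqP; rewrite oner_eq0.
move=> j _; have /eqP := h (fun i _ => p0 i) j isT.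
by rewrite mulf_eq0 [X in _ || X]gt_eqF ?orbF ?normal_pdf_gt0 ?sdev_gt0// => /eqP.
Qed.

End log_likelihood.

Section consistency.
Context {R : realType} {m : nat}.
Variables (m_gt0 : (0 < m)%N) (Gs : mixing R m) (x : nat -> R)
  (G : nat -> mixing R m) (q : nat -> R -> R) (pen : nat -> mixing R m -> R).
Notation mu := (@lebesgue_measure R).
Let f := mixture_pdf Gs.

(** Rational parameters make the family of test functions countable, so one null set serves them
    all. *)
Definition rational_sum (p : {ffun 'I_m -> rat * rat * rat}) : R -> R :=
  normal_sum (fun j => ratr (p j).1.1) (fun j => ratr (p j).1.2) (fun j => ratr (p j).2).

(* The weights of a rational sum are not required to add up to 1. *)
Definition positive_params (p : {ffun 'I_m -> rat * rat * rat}) : Prop :=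
  forall j, 0 < (p j).1.1 /\ 0 < (p j).2.

Definition root4_test p (k : nat) (y : R) : R :=
  root4 ((rational_sum p y + k.+1%:R^-1) / f y).

Hypothesis window_count : exists2 C : R, 0 < C &
  \forall n \near \oo, forall t r : R, 0 <= r ->
    #|[pred i : 'I_n | `|x i - t| <= r]|%:R <= C * (n%:R * r + ln n%:R) :> R.
Hypothesis test_means : forall p k, positive_params p -> forall e, 0 < e ->
  \forall n \near \oo, \sum_(i < n) root4_test p k (x i) <=
    n%:R * (fine (\int[mu]_y (root4_test p k y * f y)%:E)%E + e).
Hypotheses (P1 : penalty_P1 pen q) (P2 : penalty_P2 q) (P3 : penalty_P3 q).
Hypothesis G_mle : \forall n \near \oo, is_penalized_mle pen x n (G n).

Let f_gt0 y : 0 < f y. Proof. exact: mixture_pdf_gt0. Qed.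

Let f_cont : continuous f.
Proof. by apply: normal_sum_continuous; exact: sdev_gt0. Qed.

Lemma penalty_le e : 0 < e -> \forall n \near \oo, forall s : R, 0 < s -> q n s <= e * n%:R.
Proof.
move=> e0; have [+ _] := P2; move/fine_cvgP => [fin_near].
move/cvgrPdist_lt => /(_ e e0) h.
apply: filterS3 fin_near h (near_le_natr (1 : R)) => n.
set S := ereal_sup _ => fS hS n1 s s0.
have n0 : 0 < n%:R :> R by exact: lt_le_trans n1.
have le_S : ((Num.max (q n s) 0)%:E <= S)%E by apply: ereal_sup_ubound; exists s.
move: hS; rewrite /= -/S sub0r normrN => /(le_lt_trans (ler_norm _)).
rewrite -lte_fin fineK// => hS.
have : ((Num.max (q n s) 0)%:E * (n%:R^-1)%:E < e%:E)%E.
  by apply: le_lt_trans hS; rewrite lee_wpmul2r// lee_fin invr_ge0.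
rewrite -EFinM lte_fin ltr_pdivrMr// => /ltW; apply: le_trans.
by rewrite le_max lexx.
Qed.

Lemma penalty_ge s e : 0 < s -> 0 < e -> \forall n \near \oo, - (e * n%:R) <= q n s.
Proof.
move=> s0 e0; have [_ /(_ s s0)] := P2.
move/cvgrPdist_lt => /(_ e e0) h; near=> n.
have n0 : 0 < n%:R :> R.
  by apply: lt_le_trans ltr01 _; near: n; exact: near_le_natr.
have : `|0 - q n s / n%:R| < e by near: n.
rewrite sub0r normrN ltr_norml => /andP[+ _].
by rewrite ltr_pdivlMr// mulNr => /ltW.
Unshelve. all: by end_near. Qed.

Lemma rational_sum_ge0 p y : positive_params p -> 0 <= rational_sum p y.
Proof.
move=> pp; apply: normal_sum_ge0 => j.
by rewrite ler0q ltW//; case: (pp j).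
Qed.

(** Markov's inequality on the sample: a single test already dominates root4 (1 / f), which is large
    far out since [f] vanishes at infinity, and its sample mean stays bounded. *)
Lemma tail_frequencies (e : R) : 0 < e -> exists T : R, \forall n \near \oo,
  #|[pred i : 'I_n | T < `|x i|]|%:R <= e * n%:R :> R.
Proof.
move=> e0; pose p : {ffun 'I_m -> rat * rat * rat} := [ffun=> (1, 0, 1)].
have pp : positive_params p by move=> j; rewrite /p ffunE.
have Hn := test_means 0 pp ltr01.
set K := fine _ in Hn.
pose L := `|K + 1| / e + 1.
have L1 : 1 <= L by rewrite /L lerDr divr_ge0// ltW.
have L0 : 0 < L by exact: lt_le_trans L1.
have w0 j : 0 <= weight Gs j by exact: weight_ge0.
have L4 : 0 < L ^- 4 by rewrite invr_gt0 exprn_gt0.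
have [T HT] := normal_sum_vanishes (mean Gs) w0 (@sdev_gt0 _ _ Gs) L4.
exists T; apply: filterS Hn => n Hn.
have : #|[pred i : 'I_n | T < `|x i|]|%:R * L <= n%:R * (K + 1).
  apply: le_trans Hn; rewrite mulr_natl -sumr_const big_mkcond/=.
  apply: ler_sum => i _; rewrite inE; case: ifPn => [Ti|_]; last exact: root4_ge0.
  have -> : L = root4 (L ^+ 4).
    rewrite /root4 (exprM _ 2 2) sqrtr_sqr ger0_norm ?sqr_ge0//.
    by rewrite sqrtr_sqr ger0_norm// ltW.
  apply: ler_root4; rewrite invr1 ler_pdivlMr//.
  apply: (@le_trans _ _ 1); last by rewrite lerDr rational_sum_ge0.
  by rewrite mulrC -ler_pdivlMr ?exprn_gt0// mul1r HT.
have K1 : K + 1 <= e * L.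
  rewrite /L mulrDr mulrCA divff ?gt_eqF// !mulr1 (le_trans (ler_norm _))//.
  by rewrite lerDl ltW.
have : n%:R * (K + 1) <= n%:R * (e * L) by rewrite ler_wpM2l.
move=> h1 h2; rewrite -(ler_pM2r L0); lra.
Qed.

(** * Identification of the limit along an ultrafilter *)

Section along_ultrafilter.
Variables (U : set_system nat) (U_ultra : UltraFilter U) (U_oo : \oo `<=` U).
Variables (b t0 s0 a0 : 'I_m -> R).
Hypotheses (b_le : forall j, 0 <= b j <= a0 j) (s0_gt0 : forall j, 0 < s0 j)
  (a_cvg : forall j e, 0 < e -> \forall n \near U, `|weight (G n) j - a0 j| <= e)
  (ts_cvg : forall j e, 0 < e -> \forall n \near U,
     b j * (`|mean (G n) j - t0 j| + `|sdev (G n) j - s0 j|) <= e)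
  (G_absorbed : forall j e d, 0 < e -> 0 < d -> \forall n \near U,
     absorbed x q n (weight (G n) j) (mean (G n) j) (sdev (G n) j) e d
       (fun y => b j * normal_pdf (t0 j) (s0 j) y)).

Let near_U (Q : nat -> Prop) : (\forall n \near \oo, Q n) -> \forall n \near U, Q n.
Proof. by move=> h; exact: U_oo. Qed.

Let f0 := normal_sum b t0 s0.
Let b_ge0 j : 0 <= b j. Proof. by case/andP: (b_le j). Qed.
Let f0_ge0 y : 0 <= f0 y. Proof. exact: normal_sum_ge0. Qed.

Let m0 : 0 < m%:R :> R. Proof. by rewrite ltr0n. Qed.

Lemma near_all_ord (Q : 'I_m -> nat -> Prop) (F : set_system nat) : Filter F ->
  (forall j, \forall n \near F, Q j n) -> \forall n \near F, forall j, Q j n.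
Proof.
move=> FF H; have h (r : seq 'I_m) : \forall n \near F, forall j, j \in r -> Q j n.
  elim: r => [|j r IH]; first by apply: nearW.
  apply: filterS2 (H j) IH => n h1 h2 i; rewrite inE => /orP[/eqP -> //|].
  exact: h2.
by apply: filterS (h (enum 'I_m)) => n hn j; apply: hn; rewrite mem_enum.
Qed.

(** The maximizer is compared with the truth. Each component costs one [e] in the density and d n in
    the objective, and the penalty at the truth costs d n more per component; the total 2 m d n is
    divided by the 4 of [ln_le_root4]. *)
Lemma mle_root4_sum_ge (e d : R) : 0 < e -> 0 < d -> \forall n \near U,
  n%:R <= \sum_(i < n) root4 ((f0 (x i) + m%:R * e) / f (x i)) + m%:R * d / 2 * n%:R.
Proof.
move=> e0 d0.
have absU := near_all_ord (@ultra_proper _ _ U_ultra) (fun j => G_absorbed j e0 d0).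
have penU : \forall n \near \oo, forall j : 'I_m, - (d * n%:R) <= q n (sdev Gs j).
  by apply: near_all_ord => j; exact: penalty_ge (sdev_gt0 Gs j) d0.
near=> n.
have mle : is_penalized_mle pen x n (G n) by near: n; exact: near_U.
have abs_n : forall j, absorbed x q n (weight (G n) j) (mean (G n) j) (sdev (G n) j) e d
       (fun y => b j * normal_pdf (t0 j) (s0 j) y) by near: n.
have pen_n : forall j, - (d * n%:R) <= q n (sdev Gs j) by near: n; exact: near_U.
have /choice[E HE] : forall j : 'I_m, exists E : nat -> R,
    (forall i, 0 <= E i /\ weight (G n) j * normal_pdf (mean (G n) j) (sdev (G n) j) (x i)
       <= b j * normal_pdf (t0 j) (s0 j) (x i) + e + E i) /\
    \sum_(i < n) ln (1 + E i / e) + q n (sdev (G n) j) <= d * n%:R.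
  by move=> j; have [E h1 h2] := abs_n j; exists E.
have := mle Gs; rewrite /penalized_loglik !P1 => mleG.
pose A i := f0 (x i) + m%:R * e.
have A0 i : e <= A i.
  rewrite /A (le_trans (_ : _ <= m%:R * e))//; last by rewrite lerDr.
  by rewrite ler_peMl ?(ltW e0)// ler1n.
have lik : loglik x n (G n) <= \sum_(i < n) ln (A i) +
    \sum_(j < m) \sum_(i < n) ln (1 + E j i / e).
  rewrite exchange_big -big_split/=; apply: ler_sum => i _.
  apply: (@le_trans _ _ (ln (A i + \sum_(j < m) E j i))).
    rewrite ler_ln ?posrE ?mixture_pdf_gt0//; last first.
      rewrite ltr_pwDl ?(lt_le_trans e0)// sumr_ge0// => j _.
      by have [/(_ i)[]] := HE j.
    rewrite /A (_ : m%:R * e = \sum_(j < m) e); last first.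
      by rewrite sumr_const card_ord mulr_natl.
    rewrite /f0 /normal_sum -!big_split/=.
    by apply: ler_sum => j _; have [/(_ i)[]] := HE j.
  apply: ln_add_sum_le => // j; by have [/(_ i)[]] := HE j.
have s1 : \sum_(j < m) \sum_(i < n) ln (1 + E j i / e) +
    \sum_(j < m) q n (sdev (G n) j) <= m%:R * (d * n%:R).
  rewrite -big_split/= mulr_natl -[X in _ *+ X](card_ord m) -sumr_const.
  by apply: ler_sum => j _; have [] := HE j.
have s2 : - (m%:R * (d * n%:R)) <= \sum_(j < m) q n (sdev Gs j).
  rewrite -mulrN mulr_natl -[X in _ *+ X](card_ord m) -sumr_const.
  by apply: ler_sum => j _.
have s3 : \sum_(i < n) ln (A i) - loglik x n Gs <=
    4 * (\sum_(i < n) root4 (A i / f (x i)) - n%:R).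
  rewrite /loglik -sumrB mulrBr mulr_sumr.
  rewrite (_ : 4 * n%:R = \sum_(i < n) 4); last by rewrite sumr_const card_ord mulr_natr.
  rewrite -sumrB; apply: ler_sum => i _.
  have Ai : 0 < A i by exact: lt_le_trans (A0 i).
  rewrite -lnV ?posrE// -lnM ?posrE ?invr_gt0//.
  rewrite (le_trans (ln_le_root4 _)) ?divr_gt0//.
  by rewrite mulrBr mulr1.
have : n%:R <= \sum_(i < n) root4 (A i / f (x i)) + m%:R * d / 2 * n%:R by lra.
by [].
Unshelve. all: by end_near. Qed.

Lemma rational_sum_approx (e : R) : 0 < e -> exists2 p, positive_params p &
  forall y, `|rational_sum p y - f0 y| <= e.
Proof.
move=> e0; have em : 0 < e / m%:R by rewrite divr_gt0.
have each j : exists r : rat * rat * rat, [/\ 0 < r.1.1, 0 < r.2 &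
    forall y, `|ratr r.1.1 * normal_pdf (ratr r.1.2) (ratr r.2) y -
      b j * normal_pdf (t0 j) (s0 j) y| <= e / m%:R].
  have [eta eta0 H] := weighted_normal_pdf_param_continuous (b j) (t0 j) (s0_gt0 j) em.
  (* Approximation from above keeps weights and deviations positive, even where [b j] is 0. *)
  have near_rat (z : R) : exists2 r : rat, z < ratr r & `|ratr r - z| <= eta.
    have zeta : z < z + eta by rewrite ltrDl.
    have [r] := rat_in_itvoo zeta.
    rewrite in_itv/= => /andP[h1 h2]; exists r => //.
    by rewrite ger0_norm; lra.
  have [ra ha1 ha2] := near_rat (b j).
  have [rt ht1 ht2] := near_rat (t0 j).
  have [rs hs1 hs2] := near_rat (s0 j).
  exists (ra, rt, rs); split => /=.
  - by rewrite -(ltr0q R) (le_lt_trans (b_ge0 j)).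
  - by rewrite -(ltr0q R) (lt_trans (s0_gt0 j)).
  - by move=> y; have [_] := H _ _ _ ha2 ht2 hs2; exact.
have [r hr] := choice each.
exists [ffun j => r j]; first by move=> j; rewrite ffunE; case: (hr j).
move=> y; rewrite /rational_sum /f0 /normal_sum -sumrB.
rewrite (le_trans (ler_norm_sum _ _ _))//.
rewrite (_ : e = \sum_(j < m) e / m%:R); last first.
  by rewrite sumr_const card_ord -[RHS]mulr_natr divfK// gt_eqF.
by apply: ler_sum => j _; rewrite !ffunE; have [_ _] := hr j; exact.
Qed.

(** One half of the constant 1/(k+1) is left for the error in approximating [f0] by the rational
    sum; the other half is the m e of [mle_root4_sum_ge]. *)
Lemma root4_test_affinity p k : positive_params p ->
  (forall y, f0 y + k.+1%:R^-1 / 2 <= rational_sum p y + k.+1%:R^-1) ->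
  (1 <= \int[mu]_y (root4_test p k y * f y)%:E)%E.
Proof.
move=> pp hp; set I := (\int[mu]_y _)%E.
have k0 : 0 < k.+1%:R^-1 :> R by rewrite invr_gt0 ltr0n.
pose e : R := k.+1%:R^-1 / 2 / m%:R; have e0 : 0 < e by rewrite !divr_gt0.
have fine1 : 1 <= fine I.
  apply/ler_addgt0Pr => d d0.
  (* Solves d1 + m d1 / 2 = d, the sum of the errors from the law of large numbers and from the
     likelihood comparison. *)
  pose d1 := d / (1 + m%:R / 2); have c0 : 0 < 1 + m%:R / 2 :> R.
    by rewrite ltr_pwDl// divr_ge0.
  have d10 : 0 < d1 by rewrite divr_gt0.
  have [n [[h1 h2] h3]] := filter_ex (filterI (filterI (mle_root4_sum_ge e0 d10)
    (near_U (test_means k pp d10))) (near_U (near_le_natr (1 : R)))).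
  have n0 : 0 < n%:R :> R by exact: lt_le_trans h3.
  have h4 : \sum_(i < n) root4 ((f0 (x i) + m%:R * e) / f (x i)) <=
      \sum_(i < n) root4_test p k (x i).
    apply: ler_sum => i _; apply: ler_root4; rewrite ler_pM2r ?invr_gt0//.
    by rewrite /e mulrCA divff ?gt_eqF// mulr1.
  have : n%:R * 1 <= n%:R * (fine I + d).
    rewrite mulr1; have -> : d = d1 + m%:R * d1 / 2.
      by rewrite /d1; field; rewrite gt_eqF//; lra.
    by move: h1 h2 h4; rewrite -/I; lra.
  by rewrite ler_pM2l.
case: I fine1 => [r||] //=; last by rewrite ler10.
by move=> _; rewrite leey.
Qed.

Lemma limit_density y : f0 y = f y.
Proof.
have w0 j : 0 <= weight Gs j by exact: weight_ge0.
have sp := @sdev_gt0 _ _ Gs.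
apply: (@density_eq_of_affinity_ge1 R f (\sum_(j < m) weight Gs j / sdev Gs j)) => //.
- by rewrite integral_normal_sum// weight_sum1.
- by move=> z; exact: normal_sum_le.
- exact: integral_sqrt_normal_sum.
- exact: normal_sum_continuous.
- rewrite integral_normal_sum// lee_fin.
  have : forall e, 0 < e -> \sum_j b j <= 1 + e.
    move=> e e0; have em : 0 < e / m%:R by rewrite divr_gt0.
    have [n hn] := filter_ex (near_all_ord (@ultra_proper _ _ U_ultra) (fun j => a_cvg j em)).
    rewrite -(weight_sum1 (G n)) (_ : e = \sum_(j < m) e / m%:R); last first.
      by rewrite sumr_const card_ord -[RHS]mulr_natr divfK// gt_eqF.
    rewrite -big_split/=; apply: ler_sum => j _.
    have := hn j; rewrite ler_distl => /andP[h1 h2]; case/andP: (b_le j) => h3 h4; lra.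
  by move=> h; apply/ler_addgt0Pr.
move=> e e0.
pose k := Num.truncn e^-1.
have ke : k.+1%:R^-1 <= e.
  by rewrite -[leRHS]invrK lef_pV2 ?posrE ?invr_gt0// ltW// truncnS_gt.
have k0 : 0 < k.+1%:R^-1 :> R by rewrite invr_gt0.
have k2 : 0 < k.+1%:R^-1 / 2 :> R by rewrite divr_gt0.
have [p pp hp] := rational_sum_approx k2.
have pcont : continuous (rational_sum p).
  by apply: normal_sum_continuous => j; rewrite ltr0q; case: (pp j).
exists (rational_sum p); split => //.
  move=> z; rewrite rational_sum_ge0//=.
  have := hp z; move: ke k0; move: (k.+1%:R^-1) => kk ke k0.
  by rewrite ler_distl => /andP[h1 h2]; lra.
apply: (@le_trans _ _ (\int[mu]_y (root4_test p k y * f y)%:E)%E).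
  apply: root4_test_affinity => // z.
  have := hp z; move: ke k0; move: (k.+1%:R^-1) => kk ke k0.
  by rewrite ler_distl => /andP[h1 h2]; lra.
have mt c : measurable_fun setT (fun z => (root4 ((rational_sum p z + c) / f z) * f z)%:E).
  apply/measurable_EFinP; apply: measurable_funM; last exact: continuous_measurable_fun.
  by apply: continuous_measurable_fun; exact: root4_ratio_continuous.
apply: ge0_le_integral => //.
- by move=> z _; rewrite lee_fin mulr_ge0 ?root4_ge0// ltW.
- exact: mt.
- exact: mt.
move=> z _; rewrite lee_fin ler_wpM2r ?(ltW (f_gt0 z))//.
by apply: ler_root4; rewrite ler_pM2r ?invr_gt0// lerD2l.
Qed.

(** f0 - f is a vanishing signed combination of 2 m normal densities, indexed by the disjoint sum.
    The full predicate then gives the total mass, and quadrants give the c.d.f. *)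
Lemma limit_cdf (Q : pred (R * R)) : \sum_(j < m | Q (mean Gs j, sdev Gs j)) weight Gs j =
  \sum_(j < m | Q (t0 j, s0 j)) b j.
Proof.
pose c (i : 'I_m + 'I_m) := match i with inl j => b j | inr j => - weight Gs j end.
pose p (i : 'I_m + 'I_m) := match i with
  inl j => (t0 j, s0 j) | inr j => (mean Gs j, sdev Gs j) end.
have := @normal_mixture_identifiable R _ c p.
have p0 i : 0 < (p i).2 by case: i => j /=; [exact: s0_gt0|exact: sdev_gt0].
have c0 y : \sum_i c i * normal_pdf (p i).1 (p i).2 y = 0.
  rewrite big_sumType/= -[X in X + _]/(f0 y) limit_density.
  rewrite (eq_bigr (fun j => - (weight Gs j * normal_pdf (mean Gs j) (sdev Gs j) y))).
    by rewrite sumrN subrr.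
  by move=> j _; rewrite mulNr.
move=> /(_ p0 c0 Q); rewrite big_sumType/= sumrN => /eqP.
by rewrite subr_eq0 => /eqP.
Qed.

Lemma D_KW_near (e : R) : 0 < e -> \forall n \near U, (D_KW (G n) Gs <= e%:E)%E.
Proof.
move=> e0; have b1 : \sum_(j < m) b j = 1.
  by rewrite -(limit_cdf xpredT) weight_sum1.
have a1 : \sum_(j < m) a0 j <= 1.
  apply/ler_addgt0Pr => d d0; have dm : 0 < d / m%:R by rewrite divr_gt0.
  have [n hn] := filter_ex (near_all_ord (@ultra_proper _ _ U_ultra) (fun j => a_cvg j dm)).
  rewrite -(weight_sum1 (G n)) (_ : d = \sum_(j < m) d / m%:R); last first.
    by rewrite sumr_const card_ord -[RHS]mulr_natr divfK// gt_eqF.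
  rewrite -big_split/=; apply: ler_sum => j _.
  by have := hn j; rewrite ler_distl => /andP[h1 h2]; lra.
(* The [b j] sum to 1 and lie below the [a0 j], whose sum is at most 1. Hence no component loses
   mass, and each one with positive limit weight has convergent parameters. *)
have ab j : a0 j = b j.
  apply/eqP; rewrite -subr_eq0; apply/eqP.
  have d0 i : 0 <= a0 i - b i by rewrite subr_ge0; case/andP: (b_le i).
  have : \sum_(i < m) (a0 i - b i) = 0.
    by apply/eqP; rewrite eq_le sumr_ge0 ?andbT// sumrB b1 subr_le0.
  by move/psumr_eq0P => /(_ (fun i _ => d0 i)) /(_ j isT).
(* The 6 is 4 + 2, the two constants of [D_KW_le]. *)
pose c := e / m%:R / 6; have c0 : 0 < c by rewrite !divr_gt0.
near=> n.
have h1 : forall j, `|weight (G n) j - a0 j| <= c.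
  by near: n; apply: near_all_ord => j; exact: a_cvg.
have h2 : forall j, b j * (`|mean (G n) j - t0 j| + `|sdev (G n) j - s0 j|) <= c.
  by near: n; apply: near_all_ord => j; exact: ts_cvg.
apply: (le_trans (@D_KW_le R m (G n) Gs b t0 s0 b_ge0 _)).
  by move=> v; exact: (limit_cdf (fun w => (w.1 <= v.1) && (w.2 <= v.2))).
rewrite lee_fin (_ : e = \sum_(j < m) e / m%:R); last first.
  by rewrite sumr_const card_ord -[RHS]mulr_natr divfK// gt_eqF.
apply: ler_sum => j _; have := h1 j; have := h2 j; rewrite ab /c; lra.
Unshelve. all: by end_near. Qed.
End along_ultrafilter.

(** If the bad indices were unbounded, some ultrafilter finer than n -> oo would contain them; along
    it the distance is nevertheless at most [e], a contradiction. *)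
Lemma D_KW_eventually_le (e : R) : 0 < e -> \forall n \near \oo, (D_KW (G n) Gs <= e%:E)%E.
Proof.
move=> e0; apply: contrapT => nfar.
pose B := [set n | ~ (D_KW (G n) Gs <= e%:E)%E].
have BF : ProperFilter (within B \oo).
  split; last exact: within_filter.
  rewrite /within /= => h; apply: nfar; move: h; apply: filterS => n h.
  by apply: contrapT => Bn; exact: h.
have [U [U_ultra FU]] := ultraFilterLemma BF.
have U_oo : \oo `<=` U.
  by move=> A Ao; apply: FU; apply: filterS Ao => n An _.
have UB : U B by apply: FU; rewrite /within /=; exact: nearW.
have w01 n j : 0 <= weight (G n) j <= 1.
  rewrite weight_ge0/= -(weight_sum1 (G n)) (bigD1 j)//= lerDl.
  by apply: sumr_ge0 => i _; exact: weight_ge0.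
have comp (j : 'I_m) := component_limit window_count penalty_le P3 tail_frequencies U_ultra U_oo
  (fun n => mean (G n) j) (w01 ^~ j) (fun n => sdev_gt0 (G n) j).
have [b Hb] := choice comp.
have [t0 Ht] := choice Hb.
have [s0 Hs] := choice Ht.
have [a0 Ha] := choice Hs.
have := @D_KW_near U U_ultra U_oo b t0 s0 a0.
move=> /(_ _ _ _ _ _ e e0) H.
have UD : \forall n \near U, (D_KW (G n) Gs <= e%:E)%E.
  by apply: H => j; have [] := Ha j.
by have [n [Bn]] := filter_ex (filterI UB UD).
Qed.

Lemma D_KW_cvg : D_KW (G n) Gs @[n --> \oo] --> 0%E.
Proof.
have D0 n : (0 <= D_KW (G n) Gs)%E.
  by apply: integral_ge0 => v _; rewrite lee_fin mulr_ge0// expR_ge0.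
apply/fine_cvgP; split.
  apply: filterS (D_KW_eventually_le ltr01) => n h.
  by rewrite ge0_fin_numE// (le_lt_trans h)// ltry.
apply/cvgrPdist_le => e e0; apply: filterS (D_KW_eventually_le e0) => n h.
rewrite sub0r normrN ger0_norm ?fine_ge0//.
by rewrite -lee_fin fineK// ge0_fin_numE// (le_lt_trans h)// ltry.
Qed.
End consistency.

Theorem theorem3p2 (R : realType) (m : nat) (m_gt0 : (0 < m)%N)
    (d : measure_display) (Omega : measurableType d) (P : probability Omega R)
    (Gstar : mixing R m) (X : nat -> {RV P >-> R})
    (X_iid : iid_with_density X (mixture_pdf Gstar))
    (pen : nat -> mixing R m -> R) (ptilde : nat -> R -> R)
    (P1 : penalty_P1 pen ptilde)
    (P2 : penalty_P2 ptilde)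
    (P3 : penalty_P3 ptilde)
    (Gtilde : nat -> Omega -> mixing R m)
    (Gtilde_pmle : {ae P, forall w, \forall n \near \oo,
        is_penalized_mle pen (fun i => X i w) n (Gtilde n w)}) :
  {ae P, forall w, D_KW (Gtilde n w) Gstar @[n --> \oo] --> 0%E}.
Proof.
pose f := mixture_pdf Gstar.
have f_gt0 y : 0 < f y by exact: mixture_pdf_gt0.
have f_ge0 y : 0 <= f y by exact: ltW.
have w0 j : 0 <= weight Gstar j by exact: weight_ge0.
have s0 := @sdev_gt0 _ _ Gstar.
have f_cont : continuous f by exact: normal_sum_continuous.
have f_meas : measurable_fun setT f by exact: continuous_measurable_fun.
have f_le y : f y <= \sum_(j < m) weight Gstar j / sdev Gstar j by exact: normal_sum_le.
have [C C0 count_ae] := iid_window_count_bound f_ge0 f_meas f_le X_iid.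
pose T : countType := ({ffun 'I_m -> rat * rat * rat} * nat)%type.
(* The tests are numbered through [pickle], which reduces the statement to countably many
   applications of the strong law. *)
have means_ae : {ae P, forall w, forall z : T, positive_params z.1 -> forall e : R,
    0 < e -> \forall n \near \oo, \sum_(i < n) root4_test Gstar z.1 z.2 (X i w) <=
    n%:R * (fine (\int[lebesgue_measure]_y (root4_test Gstar z.1 z.2 y * f y)%:E)%E + e)}.
  have : {ae P, forall w, forall N : nat, forall z : T, unpickle N = Some z ->
    positive_params z.1 -> forall e : R,
    0 < e -> \forall n \near \oo, \sum_(i < n) root4_test Gstar z.1 z.2 (X i w) <=
    n%:R * (fine (\int[lebesgue_measure]_y (root4_test Gstar z.1 z.2 y * f y)%:E)%E + e)}.
    apply: ae_foralln => N.
    case Nz : (@unpickle T N) => [[p k]|]; last by apply: aeW => w z.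
    have [pp|npp] := pselect (positive_params p); last first.
      by apply: aeW => w z [<-] /npp.
    have pcont : continuous (rational_sum (R := R) p).
      by apply: normal_sum_continuous => j; rewrite ltr0q; case: (pp j).
    have k0 : 0 <= k.+1%:R^-1 :> R by rewrite invr_ge0.
    have tmeas : measurable_fun setT (root4_test Gstar p k).
      by apply: continuous_measurable_fun; exact: root4_ratio_continuous.
    have := iid_slln_upper_bound f_ge0 f_meas X_iid tmeas (fun y => root4_ge0 _).
    have h2 : (\int[lebesgue_measure]_y (root4_test Gstar p k y ^+ 2 * f y)%:E < +oo)%E.
      apply: (@root4_ratio_square_integrable _ f _ _ _ _ _
        (\sum_(j < m) ratr (p j).1.1 / ratr (p j).2)) => //.
      + exact: integral_sqrt_normal_sum.
      + move=> y; rewrite rational_sum_ge0//= normal_sum_le// => j.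
          by rewrite ler0q ltW//; case: (pp j).
        by rewrite ltr0q; case: (pp j).
    move=> /(_ h2); apply: filterS => w hw z [<-] _ e e0.
    exact: hw.
  apply: filterS => w hw z; exact: (hw (pickle z) z (pickleK z)).
(* From here on the sample point is fixed and the argument involves no probability. *)
apply: filterS3 count_ae means_ae Gtilde_pmle => w hcount hmeans hmle.
apply: (@D_KW_cvg R m m_gt0 Gstar (fun i => X i w) (Gtilde ^~ w) ptilde pen) => //.
- by exists C.
- by move=> p k pp e e0; exact: (hmeans (p, k) pp e e0).
Qed.
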